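(* Let $R>0$ and $\gamma>1$ be constants, and let $\tau,\mu,\kappa:\mathbb{R}^+\to\mathbb{R}^+$ be any positive $C^2$ functions. For every left-end state $(v_-,u_-,\theta_-)\in\mathbb{R}^+\times\mathbb{R}\times\mathbb{R}^+$ there exist constants $\varepsilon_0,C,C_1>0$ such that the following holds for every right-end state $(v_+,u_+,\theta_+)\in\mathbb{R}^+\times\mathbb{R}\times\mathbb{R}^+$ which satisfies, together with the left-end state, the Rankine–Hugoniot and Lax conditions stated in the context, and for which $\varepsilon:=|v_--v_+|\in(0,\varepsilon_0)$. Let $(\tilde v_\varepsilon,\tilde u_\varepsilon,\tilde\theta_\varepsilon)$ be the monotone solution of the profile ODE problem in the context with $\tilde v_\varepsilon(0)=\frac{v_-+v_+}{2}$. Put $$\sigma_\varepsilon=-\sqrt{-\tfrac{p_+-p_-}{v_+-v_-}},\quad \sigma_*=-\sqrt{\tfrac{\gamma p_-}{v_-}}=-\tfrac{\sqrt{\gamma R\theta_-}}{v_-}\quad\text{if } v_->v_+ \text{ (1-shock)},$$ $$\sigma_\varepsilon=\sqrt{-\tfrac{p_+-p_-}{v_+-v_-}},\quad \sigma_*=\sqrt{\tfrac{\gamma p_-}{v_-}}=\tfrac{\sqrt{\gamma R\theta_-}}{v_-}\quad\text{if } v_-<v_+ \text{ (3-shock)},$$ and $$A:=\frac{R\gamma\sigma_*}{R\tau(\theta_-)+R\gamma\mu(\theta_-)+(\gamma-1)^2\kappa(\theta_-)}\cdot\frac{\gamma+1}{2}.$$ Then: (1) $|(\tilde v_\varepsilon(\xi)-v_-,\tilde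 u_\varepsilon(\xi)-u_-,\tilde\theta_\varepsilon(\xi)-\theta_-)|\le C\varepsilon e^{-C_1\varepsilon|\xi|}$ for all $\xi\le0$, and $|(\tilde v_\varepsilon(\xi)-v_+,\tilde u_\varepsilon(\xi)-u_+,\tilde\theta_\varepsilon(\xi)-\theta_+)|\le C\varepsilon e^{-C_1\varepsilon|\xi|}$ for all $\xi\ge0$. (2) $|(\tilde v_\varepsilon'(\xi),\tilde u_\varepsilon'(\xi),\tilde\theta_\varepsilon'(\xi))|\le C\varepsilon^2e^{-C_1\varepsilon|\xi|}$ for all $\xi\in\mathbb{R}$. (3) $|(\tilde v_\varepsilon''(\xi),\tilde u_\varepsilon''(\xi),\tilde\theta_\varepsilon''(\xi))|\le C\varepsilon|(\tilde v_\varepsilon'(\xi),\tilde u_\varepsilon'(\xi),\tilde\theta_\varepsilon'(\xi))|$ for all $\xi\in\mathbb{R}$. (4) For all $\xi\in\mathbb{R}$, $C^{-1}|\tilde v_\varepsilon'(\xi)|\le|\tilde u_\varepsilon'(\xi)|\le C|\tilde v_\varepsilon'(\xi)|$ and $C^{-1}|\tilde v_\varepsilon'(\xi)|\le|\tilde\theta_\varepsilon'(\xi)|\le C|\tilde v_\varepsilon'(\xi)|$; more explicitly, $$|\tilde u_\varepsilon'(\xi)+\sigma_*\tilde v_\varepsilon'(\xi)|\le C\varepsilon|\tilde v_\varepsilon'(\xi)|,\qquad \Big|\tilde\theta_\varepsilon'(\xi)+\frac{(\gamma-1)p_-}{R}\tilde v_\varepsilon'(\xi)\Big|\le C\varepsilon|\tilde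 v_\varepsilon'(\xi)|.$$ (5) $|\sigma_\varepsilon-\sigma_*|\le C\varepsilon$. (6) In the 1-shock case ($\sigma_\varepsilon<0$): $\tilde v_\varepsilon'<0$, $\tilde u_\varepsilon'<0$, $\tilde\theta_\varepsilon'>0$ for all $\xi\in\mathbb{R}$. In the 3-shock case ($\sigma_\varepsilon>0$): $\tilde v_\varepsilon'>0$, $\tilde u_\varepsilon'<0$, $\tilde\theta_\varepsilon'<0$ for all $\xi\in\mathbb{R}$. (7) For all $\xi\in\mathbb{R}$, $\big|\tilde v_\varepsilon'-A(v_+-\tilde v_\varepsilon)(\tilde v_\varepsilon-v_-)\big|\le C\varepsilon(v_+-\tilde v_\varepsilon)(\tilde v_\varepsilon-v_-)$.
   Context: Notation: $\mathbb{R}^+=(0,\infty)$. The pressure is $p(v,\theta)=R\theta/v$, and the total energy is $E=\frac{R}{\gamma-1}\theta+\frac{u^2}{2}$. Write $p_\pm=p(v_\pm,\theta_\pm)$ and $E_\pm=\frac{R}{\gamma-1}\theta_\pm+\frac{u_\pm^2}{2}$. The profiles are traveling waves of the one-dimensional Brenner–Navier–Stokes–Fourier system $$v_t-u_x=\Big(\tau(\theta)\frac{v_x}{v}\Big)_x,\qquad u_t+p(v,\theta)_x=\Big(\mu(\theta)\frac{u_x}{v}\Big)_x,\qquad E_t+(p(v,\theta)u)_x=\Big(\kappa(\theta)\frac{\theta_x}{v}\Big)_x+\Big(\mu(\theta)\frac{u u_x}{v}\Big)_x .$$ Rankine–Hugoniot and Lax conditions: there exists $\sigma\in\mathbb{R}$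 such that $$-\sigma(v_+-v_-)-(u_+-u_-)=0,\quad -\sigma(u_+-u_-)+p_+-p_-=0,\quad -\sigma(E_+-E_-)+p_+u_+-p_-u_-=0,$$ and either ($v_->v_+$, $u_->u_+$, $\theta_-<\theta_+$) or ($v_-<v_+$, $u_->u_+$, $\theta_->\theta_+$). Profile ODE problem: find classical $(\tilde v,\tilde u,\tilde\theta):\mathbb{R}\to\mathbb{R}^+\times\mathbb{R}\times\mathbb{R}^+$ with (writing $'=d/d\xi$) $$-\sigma\tilde v'-\tilde u'=\Big(\tau(\tilde\theta)\frac{\tilde v'}{\tilde v}\Big)',\qquad -\sigma\tilde u'+p(\tilde v,\tilde\theta)'=\Big(\mu(\tilde\theta)\frac{\tilde u'}{\tilde v}\Big)',$$ $$-\sigma\Big(\frac{R}{\gamma-1}\tilde\theta+\frac{\tilde u^2}{2}\Big)'+(p(\tilde v,\tilde\theta)\tilde u)'=\Big(\kappa(\tilde\theta)\frac{\tilde\theta'}{\tilde v}\Big)'+\Big(\mu(\tilde\theta)\frac{\tilde u\tilde u'}{\tilde v}\Big)',$$ $$\lim_{\xi\to\pm\infty}(\tilde v,\tilde u,\tilde\theta)(\xi)=(v_\pm,u_\pm,\theta_\pm),$$ where $\sigma=-\sqrt{-\frac{p_+-p_-}{v_+-v_-}}$ if $v_->v_+$ and $\sigma=\sqrt{-\frac{p_+-p_-}{v_+-v_-}}$ if $v_-<v_+$. ''Monotone solution'' means a solution each of whose three components is monotone; for $\varepsilon$ small enough (depending on the left-end state) such a solution exists and is unique up to translation in $\xi$,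 so the normalization $\tilde v_\varepsilon(0)=\frac{v_-+v_+}{2}$ selects exactly one. *)

(* Defs.v *)
From Stdlib Require Import Reals.
From Coquelicot Require Import Coquelicot.
Open Scope R_scope.

Definition C2_on (D : R -> Prop) (f : R -> R) : Prop :=
  forall x : R, D x ->
    (forall k : nat, (k <= 2)%nat -> ex_derive_n f k x) /\
    continuous (Derive_n f 2) x.

(* A positive C^2 function on (0, +oo) is given by a total function whose
   values on (-oo, 0] are unconstrained; they never enter the system, since
   the temperature is positive. *)
Definition positive_C2 (f : R -> R) : Prop :=
  (forall x : R, 0 < x -> 0 < f x) /\ C2_on (fun x => 0 < x) f.

Definition monotone (f : R -> R) : Prop := increasing f \/ decreasing f.

Definition norm3 (a b c : R) : R := sqrt (a ^ 2 + b ^ 2 + c ^ 2).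

(* [Rg] is the gas constant R. *)
Definition pressure (Rg v th : R) : R := Rg * th / v.

Definition energy (Rg gamma u th : R) : R := Rg / (gamma - 1) * th + u ^ 2 / 2.

Definition Rankine_Hugoniot (Rg gamma vm um thm vp up thp : R) : Prop :=
  exists sigma : R,
    - sigma * (vp - vm) - (up - um) = 0 /\
    - sigma * (up - um) + pressure Rg vp thp - pressure Rg vm thm = 0 /\
    - sigma * (energy Rg gamma up thp - energy Rg gamma um thm)
      + pressure Rg vp thp * up - pressure Rg vm thm * um = 0.

Definition Lax (vm um thm vp up thp : R) : Prop :=
  (vm > vp /\ um > up /\ thm < thp) \/ (vm < vp /\ um > up /\ thm > thp).

(* 1-shocks (vp < vm) move to the left, 3-shocks (vm < vp) to the right. *)
Definition shock_speed (Rg vm thm vp thp : R) : R :=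
  let s := sqrt (- ((pressure Rg vp thp - pressure Rg vm thm) / (vp - vm))) in
  if Rlt_dec vp vm then - s else s.

Definition limit_speed (Rg gamma vm thm vp : R) : R :=
  let s := sqrt (gamma * pressure Rg vm thm / vm) in
  if Rlt_dec vp vm then - s else s.

Definition profile_system (Rg gamma : R) (tau mu kappa : R -> R) (sigma : R)
    (v u th : R -> R) : Prop :=
  forall xi : R,
    - sigma * Derive v xi - Derive u xi
      = Derive (fun x => tau (th x) * (Derive v x / v x)) xi /\
    - sigma * Derive u xi + Derive (fun x => pressure Rg (v x) (th x)) xi
      = Derive (fun x => mu (th x) * (Derive u x / v x)) xi /\
    - sigma * Derive (fun x => energy Rg gamma (u x) (th x)) xi
      + Derive (fun x => pressure Rg (v x) (th x) * u x) xi
      = Derive (fun x => kappa (th x) * (Derive th x / v x)) xi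
        + Derive (fun x => mu (th x) * (u x * Derive u x / v x)) xi.

Definition profile_solution (Rg gamma : R) (tau mu kappa : R -> R)
    (vm um thm vp up thp : R) (v u th : R -> R) : Prop :=
  (forall xi : R, 0 < v xi) /\ (forall xi : R, 0 < th xi) /\
  C2_on (fun _ => True) v /\ C2_on (fun _ => True) u /\
  C2_on (fun _ => True) th /\
  profile_system Rg gamma tau mu kappa (shock_speed Rg vm thm vp thp) v u th /\
  is_lim v m_infty vm /\ is_lim u m_infty um /\ is_lim th m_infty thm /\
  is_lim v p_infty vp /\ is_lim u p_infty up /\ is_lim th p_infty thp.

Definition monotone_profile (Rg gamma : R) (tau mu kappa : R -> R)
    (vm um thm vp up thp : R) (v u th : R -> R) : Prop :=
  profile_solution Rg gamma tau mu kappa vm um thm vp up thp v u th /\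
  monotone v /\ monotone u /\ monotone th.

Definition coefA (Rg gamma : R) (tau mu kappa : R -> R) (vm thm vp : R) : R :=
  Rg * gamma * limit_speed Rg gamma vm thm vp
    / (Rg * tau thm + Rg * gamma * mu thm + (gamma - 1) ^ 2 * kappa thm)
    * ((gamma + 1) / 2).

(* Main.v *)
(* Integrating the profile equations from -oo turns them into flux equations whose right-hand
   sides are quadratic in the deviation (V, U, T) from the left state.  At speed sigma_* their
   linearization there has a one-dimensional kernel and two fast directions whose
   eigenvalues have the sign of - sigma_*.  Differentiating the flux equations gives a linear
   system for the derivative along the orbit; a quadratic form measuring its fast components,
   minus a multiple of eps^2 times the full square norm, grows exponentially (in the
   direction of time given by that sign) as soon as it is positive.  A profile is bounded, so
   the fast components of (v', u', th') are O(eps) relative to v'.  This slaves u', th' and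
   all second derivatives to v'.  Eliminating U and T from the flux equations then leaves, because of the
   Rankine-Hugoniot relation for the speed, v' = A (v_+ - v) (v - v_-) (1 + O(eps)),
   from which decay and signs are read off. *)

(* Only the left state is fixed, so all coefficients are frozen there, and boundedness of the
   profile does the work of a center manifold. The reason for differentiating: in the flux equations
   themselves the quadratic terms are O(eps^2), no smaller than the derivative to be resolved. The
   differentiated system is linear and homogeneous with coefficients O(eps)-close to constants, so
   its errors are relative and remain useful in the tails, where the derivative is far smaller than
   eps^2. Its unknowns are the diffusive fluxes [X1], [X2], [X3], not v', u', th': they are explicit
   in V, U, T, so their derivatives do not involve tau', mu', kappa'. The eps^2 correction of the
   quadratic form is forced: the slow component acts on the fast ones through O(eps) errors, which
   leaves a defect of size eps^2 [M] in the growth of [G]. It is harmless because the flux vector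
   changes only through its fast components, up to such errors. The coefficient A is the
   nonlinearity (gamma + 1) / 2 divided by the combination of tau, mu, kappa felt along the kernel
   direction. *)
Require Import Defs.
From Stdlib Require Import Reals Lra Lia.
From Coquelicot Require Import Coquelicot.
Open Scope R_scope.

Definition bigO {I : Type} (F : (I -> Prop) -> Prop) (f g : I -> R) : Prop :=
  exists C : R, 0 <= C /\ F (fun i => Rabs (f i) <= C * Rabs (g i)).

Definition vanishing {I : Type} (F : (I -> Prop) -> Prop) (e : I -> R) : Prop :=
  forall d : R, 0 < d -> F (fun i => Rabs (e i) <= d).

Lemma norm3_le a b c : norm3 a b c <= Rabs a + Rabs b + Rabs c.
Proof.
assert (A := Rabs_pos a); assert (B := Rabs_pos b); assert (C := Rabs_pos c).
unfold norm3; rewrite <- (sqrt_pow2 (Rabs a + Rabs b + Rabs c)) by lra.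
apply sqrt_le_1_alt; rewrite <- (pow2_abs a), <- (pow2_abs b), <- (pow2_abs c).
generalize (Rmult_le_pos _ _ A B) (Rmult_le_pos _ _ A C) (Rmult_le_pos _ _ B C); lra.
Qed.

Lemma norm3_ge a b c : Rabs a <= norm3 a b c.
Proof.
unfold norm3; rewrite <- (sqrt_pow2 (Rabs a)), pow2_abs by apply Rabs_pos.
apply sqrt_le_1_alt; generalize (pow2_ge_0 b) (pow2_ge_0 c); lra.
Qed.

(** * Asymptotic estimates along a filter *)

Section Asymptotics.
Context {I : Type} {F : (I -> Prop) -> Prop} {FF : Filter F}.
Implicit Types f g h e : I -> R.

Lemma bigO_of_le f g C : (forall i, Rabs (f i) <= C * Rabs (g i)) -> bigO F f g.
Proof.
intros H; exists (Rmax 0 C); split; [apply Rmax_l|].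
apply filter_forall; intros i; eapply Rle_trans; [apply H|].
apply Rmult_le_compat_r; [apply Rabs_pos | apply Rmax_r].
Qed.

Lemma bigO_refl f : bigO F f f.
Proof. apply (bigO_of_le _ _ 1); intros; lra. Qed.

Lemma bigO_const (c : R) : bigO F (fun _ => c) (fun _ => 1).
Proof. apply (bigO_of_le _ _ (Rabs c)); intros; rewrite Rabs_R1; lra. Qed.

Lemma bigO_ext f g h : (forall i, f i = g i) -> bigO F f h -> bigO F g h.
Proof.
intros E (C & HC & H); exists C; split; [exact HC|].
revert H; apply filter_imp; intros i; now rewrite E.
Qed.

Lemma bigO_trans f g h : bigO F f g -> bigO F g h -> bigO F f h.
Proof.
intros (C & HC & H) (D & HD & H'); exists (C * D); split; [nra|].
generalize (filter_and _ _ H H'); apply filter_imp; intros i [A B].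
rewrite Rmult_assoc; eapply Rle_trans; [exact A|]; now apply Rmult_le_compat_l.
Qed.

Lemma bigO_plus f g h : bigO F f h -> bigO F g h -> bigO F (fun i => f i + g i) h.
Proof.
intros (C & HC & H) (D & HD & H'); exists (C + D); split; [lra|].
generalize (filter_and _ _ H H'); apply filter_imp; intros i [A B].
eapply Rle_trans; [apply Rabs_triang|]; lra.
Qed.

Lemma bigO_opp f h : bigO F f h -> bigO F (fun i => - f i) h.
Proof.
intros (C & HC & H); exists C; split; [exact HC|].
revert H; apply filter_imp; intros i; now rewrite Rabs_Ropp.
Qed.

Lemma bigO_minus f g h : bigO F f h -> bigO F g h -> bigO F (fun i => f i - g i) h.
Proof. intros A B; apply bigO_plus; [exact A | now apply bigO_opp]. Qed.

Lemma bigO_mult f g h k :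
  bigO F f h -> bigO F g k -> bigO F (fun i => f i * g i) (fun i => h i * k i).
Proof.
intros (C & HC & H) (D & HD & H'); exists (C * D); split; [nra|].
generalize (filter_and _ _ H H'); apply filter_imp; intros i [A B].
rewrite !Rabs_mult.
replace (C * D * (Rabs (h i) * Rabs (k i))) with ((C * Rabs (h i)) * (D * Rabs (k i))) by ring.
apply Rmult_le_compat; auto using Rabs_pos.
Qed.

Lemma bigO_mult_r f g h :
  bigO F f (fun _ => 1) -> bigO F g h -> bigO F (fun i => f i * g i) h.
Proof.
intros A B; eapply bigO_trans; [exact (bigO_mult _ _ _ _ A B)|].
apply (bigO_of_le _ _ 1); intros i; rewrite !Rmult_1_l; lra.
Qed.

Lemma bigO_mult_l f g h :
  bigO F f h -> bigO F g (fun _ => 1) -> bigO F (fun i => f i * g i) h.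
Proof.
intros A B; apply (bigO_ext (fun i => g i * f i)); [intros; ring|].
now apply bigO_mult_r.
Qed.

Lemma bigO_mult_sym f g h k :
  bigO F f k -> bigO F g h -> bigO F (fun i => f i * g i) (fun i => h i * k i).
Proof.
intros A B; apply (bigO_ext (fun i => g i * f i)); [intros; ring|].
now apply bigO_mult.
Qed.

Lemma bigO_scal (c : R) f h : bigO F f h -> bigO F (fun i => c * f i) h.
Proof. apply bigO_mult_r, bigO_const. Qed.

Lemma bigO_Rabs f h : bigO F f h -> bigO F (fun i => Rabs (f i)) h.
Proof.
intros (C & HC & H); exists C; split; [exact HC|].
revert H; apply filter_imp; intros i; now rewrite Rabs_Rabsolu.
Qed.

Lemma bigO_vanishing f e : vanishing F e -> bigO F f e -> vanishing F f.
Proof.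
intros He (C & HC & H) d Hd.
assert (H1 : F (fun i => Rabs (e i) <= d / (C + 1))) by (apply He, Rdiv_lt_0_compat; lra).
generalize (filter_and _ _ H H1); apply filter_imp; intros i [A B].
apply (Rle_trans _ _ _ A), Rle_trans with (C * (d / (C + 1))); [now apply Rmult_le_compat_l|].
apply Rmult_le_reg_r with (C + 1); [lra|].
replace (C * (d / (C + 1)) * (C + 1)) with (C * d) by (field; lra); nra.
Qed.

Lemma vanishing_bigO_1 e : vanishing F e -> bigO F e (fun _ => 1).
Proof.
intros He; exists 1; split; [lra|].
generalize (He 1 Rlt_0_1); apply filter_imp; intros i; rewrite Rabs_R1; lra.
Qed.

Lemma bigO_norm3 f g h k :
  bigO F f k -> bigO F g k -> bigO F h k -> bigO F (fun i => norm3 (f i) (g i) (h i)) k.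
Proof.
intros Hf Hg Hh; apply (bigO_trans _ (fun i => Rabs (f i) + Rabs (g i) + Rabs (h i))).
- apply (bigO_of_le _ _ 1); intros i.
  assert (A := norm3_le (f i) (g i) (h i)).
  rewrite (Rabs_pos_eq (norm3 _ _ _)) by apply sqrt_pos.
  rewrite (Rabs_pos_eq (_ + _ + _)); [lra|].
  repeat apply Rplus_le_le_0_compat; apply Rabs_pos.
- repeat apply bigO_plus; now apply bigO_Rabs.
Qed.

Lemma bigO_sum_l f g : bigO F f (fun i => Rabs (f i) + Rabs (g i)).
Proof.
apply (bigO_of_le _ _ 1); intros i; rewrite (Rabs_pos_eq (_ + _)).
- generalize (Rabs_pos (g i)); lra.
- apply Rplus_le_le_0_compat; apply Rabs_pos.
Qed.

Lemma bigO_sum_r f g : bigO F g (fun i => Rabs (f i) + Rabs (g i)).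
Proof.
apply (bigO_of_le _ _ 1); intros i; rewrite (Rabs_pos_eq (_ + _)).
- generalize (Rabs_pos (f i)); lra.
- apply Rplus_le_le_0_compat; apply Rabs_pos.
Qed.

(** Once C * |e| is at most 1/2, the part of the bound that contains [f] moves to the left-hand
    side. This breaks the circular estimates below, where an error is small relative to the very
    quantity being estimated. *)
Lemma bigO_absorb f g e :
  vanishing F e -> bigO F f (fun i => Rabs (g i) + Rabs (e i * f i)) -> bigO F f g.
Proof.
intros He (C & HC & H); exists (2 * C); split; [lra|].
assert (H1 : F (fun i => Rabs (e i) <= / (2 * (C + 1)))) by (apply He, Rinv_0_lt_compat; lra).
generalize (filter_and _ _ H H1); apply filter_imp; intros i [A B].
rewrite Rabs_mult, (Rabs_pos_eq (_ + _)) in A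
  by (apply Rplus_le_le_0_compat; [|apply Rmult_le_pos]; apply Rabs_pos).
assert (D : C * (Rabs (e i) * Rabs (f i)) <= / 2 * Rabs (f i)); [|lra].
rewrite <- Rmult_assoc; apply Rmult_le_compat_r; [apply Rabs_pos|].
apply Rle_trans with ((C + 1) * / (2 * (C + 1))); [|apply Req_le; field; lra].
apply Rmult_le_compat; try lra; apply Rabs_pos.
Qed.

Lemma bigO_near_nonzero f (c : R) e :
  c <> 0 -> vanishing F e -> bigO F (fun i => f i - c) e ->
  F (fun i => Rabs c / 2 <= Rabs (f i)).
Proof.
intros Hc He H.
assert (P := Rabs_pos_lt c Hc).
assert (H1 : F (fun i => Rabs (f i - c) <= Rabs c / 2))
  by (apply (bigO_vanishing _ _ He H); lra).
revert H1; apply filter_imp; intros i A.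
assert (B := Rabs_triang (c - f i) (f i)).
replace (c - f i + f i) with c in B by ring; rewrite Rabs_minus_sym in B; lra.
Qed.

Lemma bigO_inv f (c : R) e :
  c <> 0 -> vanishing F e -> bigO F (fun i => f i - c) e ->
  bigO F (fun i => / f i) (fun _ => 1).
Proof.
intros Hc He H; assert (P := Rabs_pos_lt c Hc).
exists (/ (Rabs c / 2)); split; [left; apply Rinv_0_lt_compat; lra|].
generalize (bigO_near_nonzero _ _ _ Hc He H); apply filter_imp; intros i A.
rewrite Rabs_R1, Rmult_1_r, Rabs_inv; apply Rinv_le_contravar; lra.
Qed.

Lemma bigO_inv_minus f (c : R) e :
  c <> 0 -> vanishing F e -> bigO F (fun i => f i - c) e ->
  bigO F (fun i => / f i - / c) e.
Proof.
intros Hc He H.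
assert (H' := bigO_near_nonzero _ _ _ Hc He H).
assert (A : bigO F (fun i => - / c * (/ f i * (f i - c))) e).
{ apply bigO_scal, bigO_mult_r; [now apply (bigO_inv f c e) | exact H]. }
destruct A as (C & HC & A); exists C; split; [exact HC|].
generalize (filter_and _ _ A H'); apply filter_imp; intros i [B D].
replace (/ f i - / c) with (- / c * (/ f i * (f i - c))); [exact B|].
assert (P := Rabs_pos_lt c Hc).
assert (f i <> 0) by (intros E; rewrite E, Rabs_R0 in D; lra).
field; auto.
Qed.

Lemma bigO_mult_minus f g (a b : R) e :
  vanishing F e -> bigO F (fun i => f i - a) e -> bigO F (fun i => g i - b) e ->
  bigO F (fun i => f i * g i - a * b) e.
Proof.
intros He A B.
apply (bigO_ext (fun i => (f i - a) * (g i - b) + (a * (g i - b) + b * (f i - a))));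
  [intros; ring|].
apply bigO_plus; [|apply bigO_plus; now apply bigO_scal].
apply bigO_mult_l; [exact A|].
apply (bigO_trans _ e); [exact B | now apply vanishing_bigO_1].
Qed.

(** The price of replacing a variable coefficient by its value at the left state. *)
Lemma bigO_freeze f (c : R) e g :
  bigO F (fun i => f i - c) e -> bigO F (fun i => f i * g i - c * g i) (fun i => e i * g i).
Proof.
intros A; apply (bigO_ext (fun i => (f i - c) * g i)); [intros; ring|].
apply bigO_mult; [exact A | apply bigO_refl].
Qed.

End Asymptotics.

(** * Differential inequalities *)

(** By the mean value theorem, f x * exp (- l * x) is nondecreasing. The sign of [l] is free: l = 0
    yields monotonicity, and applying the lemma to - f yields upper bounds. *)
Lemma gronwall (f f' : R -> R) (l a b : R) :
  a <= b ->
  (forall x, a <= x <= b -> is_derive f x (f' x)) ->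
  (forall x, a <= x <= b -> l * f x <= f' x) ->
  f a * exp (l * (b - a)) <= f b.
Proof.
intros Hab Hd Hl.
destruct (MVT_gen (fun x => f x * exp (- l * x)) a b
  (fun x => (f' x - l * f x) * exp (- l * x))) as (c & Hc & E).
- rewrite Rmin_left, Rmax_right by lra; intros x Hx.
  assert (D := Hd x (conj (Rlt_le _ _ (proj1 Hx)) (Rlt_le _ _ (proj2 Hx)))).
  evar_last; [apply @is_derive_mult with (1 := D)|].
  + apply (is_derive_comp exp); [apply is_derive_exp | auto_derive; [trivial | reflexivity]].
  + intros; apply Rmult_comm.
  + unfold plus, scal; simpl; unfold mult; simpl; ring.
- rewrite Rmin_left, Rmax_right by lra; intros x Hx.
  apply continuity_pt_filterlim, (ex_derive_continuous (fun x => f x * exp (- l * x))).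
  apply (ex_derive_mult f); [exists (f' x); now apply Hd | auto_derive; trivial].
- rewrite Rmin_left, Rmax_right in Hc by lra.
  assert (P : 0 <= f b * exp (- l * b) - f a * exp (- l * a)).
  { rewrite E; apply Rmult_le_pos; [|lra].
    apply Rmult_le_pos; [|left; apply exp_pos]. specialize (Hl c Hc); lra. }
  replace (l * (b - a)) with (- l * a + l * b) by ring.
  rewrite exp_plus.
  assert (Q : exp (- l * b) * exp (l * b) = 1).
  { rewrite <- exp_plus; replace (- l * b + l * b) with 0 by ring; apply exp_0. }
  assert (S := exp_pos (l * b)).
  replace (f b) with (f b * exp (- l * b) * exp (l * b)) by (rewrite Rmult_assoc, Q; ring).
  rewrite <- Rmult_assoc; apply Rmult_le_compat_r; lra.
Qed.

(** Along x + s * y with y >= 0, a positive value would grow at least like exp (l * y). The sign of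
    [s] chooses the direction of time, which lets one argument serve both shock families. *)
Lemma bounded_growth_nonpos (f f' : R -> R) (s l B : R) :
  s <> 0 -> 0 < l ->
  (forall x, is_derive f x (f' x)) ->
  (forall x, l * f x <= s * f' x) ->
  (forall x, f x <= B) ->
  forall x, f x <= 0.
Proof.
intros Hs Hl Hd Hg HB x.
destruct (Rle_or_lt (f x) 0) as [|Hp]; [assumption|exfalso].
(* Chosen so that f x * (l * t) exceeds Rabs B; the bound 1 + l * t <= exp (l * t) then contradicts
   [HB]. *)
pose (t := Rabs B / (f x * l) + 1).
assert (Ht : 0 < t).
{ unfold t; assert (0 <= Rabs B / (f x * l)); [|lra].
  apply Rmult_le_pos; [apply Rabs_pos | left; apply Rinv_0_lt_compat; nra]. }
assert (G := gronwall (fun y => f (x + s * y)) (fun y => s * f' (x + s * y)) l 0 t).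
simpl in G; rewrite Rmult_0_r, Rplus_0_r, Rminus_0_r in G.
assert (H : f x * exp (l * t) <= f (x + s * t)).
{ apply G; [lra | intros y _ | intros y _; apply Hg].
  evar_last; [apply (is_derive_comp f (fun y => x + s * y)); [apply Hd|]|].
  - auto_derive; [trivial | reflexivity].
  - unfold scal; simpl; unfold mult; simpl; ring. }
assert (E := exp_ineq1_le (l * t)).
assert (HB' := HB (x + s * t)).
assert (A : Rabs B < f x * (l * t)).
{ unfold t; replace (f x * (l * (Rabs B / (f x * l) + 1))) with (Rabs B + f x * l)
    by (field; split; lra). nra. }
assert (C := Rle_abs B). nra.
Qed.

(** Gronwall in both directions from [a]: to the left for f with rate - C, to the right for - f with
    rate C. *)
Lemma zero_propagates (f f' : R -> R) (C a : R) :
  (forall x, is_derive f x (f' x)) ->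
  (forall x, 0 <= f x) ->
  (forall x, Rabs (f' x) <= C * f x) ->
  f a = 0 -> forall x, f x = 0.
Proof.
intros Hd Hp HC Ha x; apply Rle_antisym; [|apply Hp].
destruct (Rle_or_lt x a) as [Hx|Hx].
- assert (G := gronwall f f' (- C) x a Hx (fun y _ => Hd y)).
  rewrite Ha in G.
  assert (H : f x * exp (- C * (a - x)) <= 0).
  { apply G; intros y _; specialize (HC y); apply Rabs_le_between in HC; lra. }
  assert (E := exp_pos (- C * (a - x))). nra.
- assert (G := gronwall (fun y => - f y) (fun y => - f' y) C a x (Rlt_le _ _ Hx)).
  cbv beta in G; rewrite Ha in G.
  assert (H : - 0 * exp (C * (x - a)) <= - f x); [|lra].
  apply G; intros y _; [apply (is_derive_opp f), Hd|].
  specialize (HC y); apply Rabs_le_between in HC; lra.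
Qed.

(** On an interval of length 1 far to the left, the mean value theorem equates a value of f' near L
    with a difference of two values of f near l. *)
Lemma lim_derive_zero (f f' : R -> R) (l L : R) :
  (forall x, is_derive f x (f' x)) ->
  is_lim f m_infty l -> is_lim f' m_infty L -> L = 0.
Proof.
intros Hd Hf Hf'.
destruct (Req_dec L 0) as [|HL]; [assumption|exfalso].
assert (P := Rabs_pos_lt L HL).
apply is_lim_spec in Hf; apply is_lim_spec in Hf'.
assert (P4 : 0 < Rabs L / 4) by lra.
destruct (Hf (mkposreal _ P4)) as [A HA].
destruct (Hf' (mkposreal _ P4)) as [B HB]; simpl in *.
pose (y := Rmin A B - 1).
assert (Hy : y < A /\ y < B)
  by (unfold y; split; [generalize (Rmin_l A B) | generalize (Rmin_r A B)]; lra).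
destruct (MVT_gen f (y - 1) y f') as (c & Hc & E).
- intros; apply Hd.
- intros x _; apply continuity_pt_filterlim, (ex_derive_continuous f).
  exists (f' x); apply Hd.
- rewrite Rmin_left, Rmax_right in Hc by lra.
  assert (H1 := HA y ltac:(lra)); assert (H2 := HA (y - 1) ltac:(lra)).
  assert (H3 := HB c ltac:(lra)).
  replace (f' c) with (f y - f (y - 1)) in H3 by (rewrite E; ring).
  revert H1 H2 H3 P; unfold Rabs; repeat destruct Rcase_abs; lra.
Qed.

Lemma C2_derivatives (f : R -> R) (D : R -> Prop) (x : R) :
  C2_on D f -> D x ->
  is_derive f x (Derive f x) /\ is_derive (Derive f) x (Derive_n f 2 x).
Proof.
intros H Hx; destruct (H x Hx) as [H1 _].
split; apply Derive_correct; [apply (H1 1%nat) | apply (H1 2%nat)]; lia.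
Qed.

Lemma positive_C2_near (f : R -> R) (t : R) :
  positive_C2 f -> 0 < t ->
  exists d K : R, 0 < d /\ 0 <= K /\ forall h, Rabs h <= d ->
    Rabs (f (t + h) - f t) <= K * Rabs h /\ Rabs (Derive f (t + h)) <= K.
Proof.
intros [_ Hf] Ht.
destruct (C2_derivatives _ _ _ Hf Ht) as [_ D2].
assert (C : continuous (Derive f) t) by (apply (ex_derive_continuous (Derive f)); eexists; exact D2).
destruct (proj1 (filterlim_locally (Derive f) (Derive f t)) C (mkposreal 1 Rlt_0_1)) as [d Hd].
(* Half of [d] gives a strict inequality in the ball; half of [t] keeps the arguments of f
   positive. *)
pose (d' := Rmin (d / 2) (t / 2)).
assert (P := cond_pos d).
assert (Hd' : 0 < d' /\ d' < d /\ d' < t).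
{ unfold d'; split; [apply Rmin_pos; lra|].
  split; [generalize (Rmin_l (d / 2) (t / 2)) | generalize (Rmin_r (d / 2) (t / 2))]; lra. }
assert (B : forall y, Rabs (y - t) <= d' -> Rabs (Derive f y) <= Rabs (Derive f t) + 1).
{ intros y Hy; assert (E := Hd y).
  unfold ball in E; simpl in E; unfold AbsRing_ball in E; simpl in E.
  unfold abs, minus, plus, opp in E; simpl in E.
  specialize (E ltac:(unfold Rminus in Hy; lra)).
  replace (Derive f y) with (Derive f t + (Derive f y + - Derive f t)) by ring.
  eapply Rle_trans; [apply Rabs_triang|]; lra. }
exists d', (Rabs (Derive f t) + 1); split; [lra|].
split; [generalize (Rabs_pos (Derive f t)); lra|].
intros h Hh; split.
- replace h with ((t + h) - t) at 2 by ring.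
  apply bounded_variation with (dh := Derive f); intros y Hy.
  replace (t + h - t) with h in Hy by ring.
  split; [|apply B; lra].
  refine (proj1 (C2_derivatives _ _ y Hf _)).
  assert (A := proj1 (Rabs_le_between _ _) (Rle_trans _ _ _ Hy Hh)); lra.
- apply B; replace (t + h - t) with h by ring; exact Hh.
Qed.

(** * Uniform estimates for integrated profiles *)

Section Waves.
Variables (Rg gamma : R) (tau mu kappa : R -> R) (vm thm pm ss : R).
Hypotheses (hRg : 0 < Rg) (hgamma : 1 < gamma).
Hypotheses (htau : positive_C2 tau) (hmu : positive_C2 mu) (hkappa : positive_C2 kappa).
Hypotheses (hvm : 0 < vm) (hthm : 0 < thm).
Hypotheses (hpm : pm * vm = Rg * thm) (hss : ss ^ 2 * vm = gamma * pm).

(* An integrated profile, written as a deviation from the left state.  The parameter ss is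
   sigma_*; its sign selects the shock family, so both families are treated at once. *)
Record wave := Wave {
  wVp : R; wsg : R;
  wV : R -> R; wU : R -> R; wT : R -> R;
  wV1 : R -> R; wU1 : R -> R; wT1 : R -> R;
  wV2 : R -> R; wU2 : R -> R; wT2 : R -> R;
  w_orient : 0 < ss * wVp;
  w_sign : 0 < ss * wsg;
  w_speed : wsg ^ 2 * (vm + (gamma + 1) / 2 * wVp) = gamma * pm;
  w_v_pos : forall x, 0 < vm + wV x;
  w_th_pos : forall x, 0 < thm + wT x;
  w_V_range : forall x, 0 <= wV x * wVp <= wVp ^ 2;
  w_U_range : forall x, Rabs (wU x) <= Rabs (wsg * wVp);
  w_T_range : forall x,
    Rabs (wT x) <= Rabs ((gamma - 1) / Rg * (wsg ^ 2 * wVp ^ 2 / 2 - pm * wVp));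
  w_V_0 : wV 0 = wVp / 2;
  w_nonconst : ~ (forall x, wV1 x = 0);
  w_dV : forall x, is_derive wV x (wV1 x);
  w_dU : forall x, is_derive wU x (wU1 x);
  w_dT : forall x, is_derive wT x (wT1 x);
  w_dV1 : forall x, is_derive wV1 x (wV2 x);
  w_dU1 : forall x, is_derive wU1 x (wU2 x);
  w_dT1 : forall x, is_derive wT1 x (wT2 x);
  w_mass : forall x,
    tau (thm + wT x) * (wV1 x / (vm + wV x)) = - wsg * wV x - wU x;
  w_momentum : forall x,
    mu (thm + wT x) * (wU1 x / (vm + wV x))
    = - wsg * wU x + (Rg * (thm + wT x) / (vm + wV x) - pm);
  w_energy : forall x,
    kappa (thm + wT x) * (wT1 x / (vm + wV x))
    = - wsg * (Rg / (gamma - 1)) * wT x + wsg * wU x ^ 2 / 2 + pm * wU x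
}.

(* Estimates are uniform over all profiles and all points: the index of an asymptotic relation
   is a profile together with a point of the line, and the limit is shock strength -> 0. *)
Definition small : ((wave * R -> Prop) -> Prop) := fun P =>
  exists e0, 0 < e0 /\ forall w x, Rabs (wVp w) <= e0 -> P (w, x).

Global Instance small_filter : Filter small.
Proof.
constructor.
- exists 1; split; [lra | trivial].
- intros P Q (a & Ha & HP) (b & Hb & HQ); exists (Rmin a b).
  split; [now apply Rmin_pos|].
  intros w x H; split; [apply HP | apply HQ]; eapply Rle_trans; eauto using Rmin_l, Rmin_r.
- intros P Q HPQ (a & Ha & HP); exists a; split; auto.
Qed.

Let J := (wave * R)%type.
Implicit Types i : J.

Definition eps i := wVp (fst i).
Definition sg i := wsg (fst i).
Definition V i := wV (fst i) (snd i).
Definition U i := wU (fst i) (snd i).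
Definition T i := wT (fst i) (snd i).
Definition V1 i := wV1 (fst i) (snd i).
Definition U1 i := wU1 (fst i) (snd i).
Definition T1 i := wT1 (fst i) (snd i).
Definition V2 i := wV2 (fst i) (snd i).
Definition U2 i := wU2 (fst i) (snd i).
Definition T2 i := wT2 (fst i) (snd i).
Definition v i := vm + V i.
Definition th i := thm + T i.
Definition flux (f : R -> R) (Y : J -> R) i := f (th i) * (Y i / v i).
(** These three diffusive fluxes replace [V1], [U1], [T1] as unknowns of the linear system. *)
Definition X1 := flux tau V1.
Definition X2 := flux mu U1.
Definition X3 := flux kappa T1.

Lemma pm_pos : 0 < pm.
Proof. nra. Qed.

Lemma ss_neq0 : ss <> 0.
Proof. intros E; rewrite E in hss; generalize pm_pos; nra. Qed.

Lemma v_pos i : 0 < v i.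
Proof. apply w_v_pos. Qed.

Lemma th_pos i : 0 < th i.
Proof. apply w_th_pos. Qed.

Lemma X1E i : X1 i = - sg i * V i - U i.
Proof. apply w_mass. Qed.

Lemma X2E i : X2 i = - sg i * U i + (Rg * th i / v i - pm).
Proof. apply w_momentum. Qed.

Lemma X3E i : X3 i = - sg i * (Rg / (gamma - 1)) * T i + sg i * U i ^ 2 / 2 + pm * U i.
Proof. apply w_energy. Qed.

(** * Smallness of the deviations and of the speed defect *)

Lemma vanishing_eps : vanishing small eps.
Proof. intros d Hd; exists d; split; auto. Qed.

Lemma eps_1 : bigO small eps (fun _ => 1).
Proof. apply vanishing_bigO_1, vanishing_eps. Qed.

Lemma O_eps_1 f : bigO small f eps -> bigO small f (fun _ => 1).
Proof. intros H; exact (bigO_trans _ _ _ H eps_1). Qed.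

Lemma V_eps : bigO small V eps.
Proof.
apply (bigO_of_le _ _ 1); intros [w x]; unfold V, eps; simpl.
destruct (w_V_range w x) as [A B]; assert (C := w_orient w).
apply Rabs_le_between.
assert (D : wVp w <> 0) by (intros E; rewrite E in C; lra).
unfold Rabs; destruct Rcase_abs; split; nra.
Qed.

(** Subtracting ss ^ 2 * vm = gamma * pm from [w_speed] factors as (s - ss) * (s + ss) = O(s ^ 2 *
    eps). Since s and ss have the same sign, |s + ss| >= |ss| and the second factor can be divided
    out. *)
Lemma sg_ss : bigO small (fun i => sg i - ss) eps.
Proof.
assert (P := pm_pos); assert (N := ss_neq0).
exists (Rabs ss * (gamma + 1) / vm); split.
{ apply Rmult_le_pos; [|left; now apply Rinv_0_lt_compat].
  apply Rmult_le_pos; [apply Rabs_pos | lra]. }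
(* For such strengths vm + (gamma + 1) / 2 * eps is at least vm / 2, whence s ^ 2 <= 2 * ss ^ 2. *)
exists (vm / (gamma + 1)); split; [apply Rdiv_lt_0_compat; lra|].
intros w x Hw; unfold sg, eps; simpl.
assert (A := w_sign w); assert (B := w_speed w).
set (s := wsg w) in *; set (e := wVp w) in *.
assert (He : Rabs ((gamma + 1) / 2 * e) <= vm / 2).
{ rewrite Rabs_mult, (Rabs_pos_eq ((gamma + 1) / 2)) by lra.
  apply Rle_trans with ((gamma + 1) / 2 * (vm / (gamma + 1))).
  - apply Rmult_le_compat_l; lra.
  - apply Req_le; field; lra. }
assert (He' := proj1 (Rabs_le_between _ _) He).
assert (S2 : s ^ 2 <= 2 * ss ^ 2).
{ apply Rmult_le_reg_r with (vm / 2); [lra|].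
  replace (2 * ss ^ 2 * (vm / 2)) with (ss ^ 2 * vm) by field.
  rewrite hss, <- B; apply Rmult_le_compat_l; [apply pow2_ge_0 | lra]. }
assert (E : (s - ss) * (s + ss) = - (s ^ 2 * ((gamma + 1) / (2 * vm)) * e)).
{ apply Rmult_eq_reg_r with vm; [|lra].
  replace ((s - ss) * (s + ss) * vm) with (s ^ 2 * vm - ss ^ 2 * vm) by ring.
  rewrite hss, <- B; field; lra. }
apply (f_equal Rabs) in E; rewrite Rabs_mult, Rabs_Ropp, !Rabs_mult in E.
assert (Q : 0 < (gamma + 1) / (2 * vm)) by (apply Rdiv_lt_0_compat; lra).
rewrite (Rabs_pos_eq (s ^ 2)), (Rabs_pos_eq ((gamma + 1) / (2 * vm))) in E by (try apply pow2_ge_0; lra).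
assert (L : Rabs ss <= Rabs (s + ss)).
{ apply Rsqr_le_abs_0; unfold Rsqr; nra. }
assert (PS := Rabs_pos_lt ss N).
apply Rmult_le_reg_r with (Rabs ss); [exact PS|].
apply Rle_trans with (Rabs (s - ss) * Rabs (s + ss)).
{ apply Rmult_le_compat_l; [apply Rabs_pos | exact L]. }
rewrite E.
replace (Rabs ss * (gamma + 1) / vm * Rabs e * Rabs ss)
  with (2 * Rabs ss ^ 2 * ((gamma + 1) / (2 * vm)) * Rabs e) by (field; lra).
rewrite pow2_abs.
apply Rmult_le_compat_r; [apply Rabs_pos|].
apply Rmult_le_compat_r; lra.
Qed.

Ltac bigO_atom := solve [apply bigO_const | apply bigO_refl | auto with bigO nocore].
Ltac bigO :=
  first
  [ bigO_atom
  | apply bigO_plus; [bigO | bigO]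
  | apply bigO_minus; [bigO | bigO]
  | apply bigO_opp; bigO
  | apply bigO_mult; [bigO | bigO]
  | apply bigO_mult_sym; [bigO | bigO]
  | apply bigO_mult_r; [bigO | bigO]
  | apply bigO_mult_l; [bigO | bigO] ].

Lemma O_1_of_minus f (c : R) : bigO small (fun i => f i - c) eps -> bigO small f (fun _ => 1).
Proof.
intros H; apply (bigO_ext (fun i => (f i - c) + c)); [intros; ring|].
apply bigO_plus; [now apply O_eps_1 | apply bigO_const].
Qed.

Lemma sg_1 : bigO small sg (fun _ => 1).
Proof. exact (O_1_of_minus _ _ sg_ss). Qed.

Hint Resolve eps_1 V_eps sg_ss sg_1 : bigO.

Lemma U_eps : bigO small U eps.
Proof.
apply (bigO_trans _ (fun i => sg i * eps i)).
- apply (bigO_of_le _ _ 1); intros [w x]; rewrite Rmult_1_l; apply w_U_range.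
- bigO.
Qed.

Lemma T_eps : bigO small T eps.
Proof.
apply (bigO_trans _ (fun i => (gamma - 1) / Rg * (sg i * sg i * / 2 * eps i * eps i - pm * eps i))).
- apply (bigO_of_le _ _ 1); intros [w x]; rewrite Rmult_1_l.
  eapply Rle_trans; [apply w_T_range|]; apply Req_le; unfold sg, eps; simpl; f_equal; field; lra.
- bigO.
Qed.

Hint Resolve U_eps T_eps : bigO.
Lemma V_1 : bigO small V (fun _ => 1).
Proof. apply O_eps_1, V_eps. Qed.
Lemma U_1 : bigO small U (fun _ => 1).
Proof. apply O_eps_1, U_eps. Qed.
Lemma T_1 : bigO small T (fun _ => 1).
Proof. apply O_eps_1, T_eps. Qed.
Hint Resolve V_1 U_1 T_1 : bigO.

Lemma v_vm : bigO small (fun i => v i - vm) eps.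
Proof. apply (bigO_ext V); [intros; unfold v; ring | apply V_eps]. Qed.

Lemma th_thm : bigO small (fun i => th i - thm) eps.
Proof. apply (bigO_ext T); [intros; unfold th; ring | apply T_eps]. Qed.

Lemma inv_v_vm : bigO small (fun i => / v i - / vm) eps.
Proof. apply bigO_inv_minus; [lra | apply vanishing_eps | apply v_vm]. Qed.

Hint Resolve v_vm th_thm inv_v_vm : bigO.

(** * Freezing the coefficients at the left state *)

Lemma coef_near f :
  positive_C2 f ->
  bigO small (fun i => f (th i) - f thm) eps /\
  bigO small (fun i => Derive f (th i)) (fun _ => 1).
Proof.
intros Hf; destruct (positive_C2_near f thm Hf hthm) as (d & K & Hd & HK & H).
assert (N : small (fun i => Rabs (T i) <= d))
  by exact (bigO_vanishing _ _ vanishing_eps T_eps d Hd).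
split.
- apply (bigO_trans _ T); [|apply T_eps].
  exists K; split; [exact HK|]; revert N; apply filter_imp; intros i Hi; now apply H.
- exists K; split; [exact HK|]; revert N; apply filter_imp; intros i Hi.
  rewrite Rabs_R1, Rmult_1_r; now apply H.
Qed.

Lemma inv_coef_near f :
  positive_C2 f -> bigO small (fun i => / f (th i) - / f thm) eps.
Proof.
intros Hf; apply bigO_inv_minus; [|apply vanishing_eps | now apply coef_near].
assert (0 < f thm) by now apply Hf. lra.
Qed.

Lemma flux_inv f (Y : J -> R) i :
  positive_C2 f -> Y i = v i * / f (th i) * flux f Y i.
Proof.
intros Hf; assert (0 < f (th i)) by (apply Hf, th_pos).
assert (A := v_pos i); unfold flux; field; lra.
Qed.

(** The error is relative to the flux itself, not merely O(eps); all later slaving relations rest on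
    this. *)
Lemma flux_frozen f (Y : J -> R) :
  positive_C2 f ->
  bigO small (fun i => Y i - vm / f thm * flux f Y i) (fun i => eps i * flux f Y i).
Proof.
intros Hf.
apply (bigO_ext (fun i => v i * / f (th i) * flux f Y i - vm * / f thm * flux f Y i)).
{ intros i; now rewrite <- (flux_inv f Y i Hf). }
apply bigO_freeze, bigO_mult_minus; [apply vanishing_eps | apply v_vm | now apply inv_coef_near].
Qed.

Lemma pressure_eps : bigO small (fun i => Rg * th i / v i - pm) eps.
Proof.
apply (bigO_ext (fun i => Rg * th i * / v i - Rg * thm * / vm)).
{ intros i; rewrite <- hpm; generalize (v_pos i); intros; field; lra. }
apply bigO_mult_minus; [apply vanishing_eps | | bigO].
apply (bigO_ext (fun i => Rg * T i)); [intros; unfold th; ring | bigO].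
Qed.

Hint Resolve pressure_eps : bigO.

Lemma X1_eps : bigO small X1 eps.
Proof. apply (bigO_ext (fun i => - sg i * V i - U i)); [intros; now rewrite X1E | bigO]. Qed.

Lemma X2_eps : bigO small X2 eps.
Proof.
apply (bigO_ext (fun i => - sg i * U i + (Rg * th i / v i - pm)));
  [intros; now rewrite X2E | bigO].
Qed.

Lemma X3_eps : bigO small X3 eps.
Proof.
apply (bigO_ext (fun i =>
  - sg i * (Rg / (gamma - 1)) * T i + sg i * / 2 * U i * U i + pm * U i)).
- intros; rewrite X3E; field; lra.
- bigO.
Qed.

Definition flux_norm i := Rabs (X1 i) + Rabs (X2 i) + Rabs (X3 i).
Let en i := eps i * flux_norm i.

Lemma flux_norm_nonneg i : 0 <= flux_norm i.
Proof.
unfold flux_norm; generalize (Rabs_pos (X1 i)) (Rabs_pos (X2 i)) (Rabs_pos (X3 i)); lra.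
Qed.

Lemma X1_n : bigO small X1 flux_norm.
Proof.
apply (bigO_of_le _ _ 1); intros i; rewrite (Rabs_pos_eq (flux_norm i)) by apply flux_norm_nonneg.
unfold flux_norm.
generalize (Rabs_pos (X2 i)) (Rabs_pos (X3 i)); lra.
Qed.

Lemma X2_n : bigO small X2 flux_norm.
Proof.
apply (bigO_of_le _ _ 1); intros i; rewrite (Rabs_pos_eq (flux_norm i)) by apply flux_norm_nonneg.
unfold flux_norm.
generalize (Rabs_pos (X1 i)) (Rabs_pos (X3 i)); lra.
Qed.

Lemma X3_n : bigO small X3 flux_norm.
Proof.
apply (bigO_of_le _ _ 1); intros i; rewrite (Rabs_pos_eq (flux_norm i)) by apply flux_norm_nonneg.
unfold flux_norm.
generalize (Rabs_pos (X1 i)) (Rabs_pos (X2 i)); lra.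
Qed.

Hint Resolve X1_n X2_n X3_n : bigO.

Lemma O_of_eps_mult f g : bigO small f (fun i => eps i * g i) -> bigO small f g.
Proof.
intros H; apply (bigO_trans _ _ _ H).
apply bigO_mult_r; [apply eps_1 | apply bigO_refl].
Qed.

(** * The differentiated flux system, linearized at the left state *)

Let d1 := vm / tau thm.
Let d2 := vm / mu thm.
Let d3 := vm / kappa thm.
Let a1 i := d1 * X1 i.
Let a2 i := d2 * X2 i.
Let a3 i := d3 * X3 i.

Lemma a1_n : bigO small a1 flux_norm.
Proof. apply bigO_scal, X1_n. Qed.
Lemma a2_n : bigO small a2 flux_norm.
Proof. apply bigO_scal, X2_n. Qed.
Lemma a3_n : bigO small a3 flux_norm.
Proof. apply bigO_scal, X3_n. Qed.

Lemma V1_a1 : bigO small (fun i => V1 i - a1 i) en.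
Proof.
apply (bigO_trans _ (fun i => eps i * X1 i)); [now apply flux_frozen | unfold en; bigO].
Qed.

Lemma U1_a2 : bigO small (fun i => U1 i - a2 i) en.
Proof.
apply (bigO_trans _ (fun i => eps i * X2 i)); [now apply flux_frozen | unfold en; bigO].
Qed.

Lemma T1_a3 : bigO small (fun i => T1 i - a3 i) en.
Proof.
apply (bigO_trans _ (fun i => eps i * X3 i)); [now apply flux_frozen | unfold en; bigO].
Qed.

Hint Resolve a1_n a2_n a3_n V1_a1 U1_a2 T1_a3 : bigO.

Lemma U1_n : bigO small U1 flux_norm.
Proof.
apply (bigO_ext (fun i => (U1 i - a2 i) + a2 i)); [intros; ring|].
apply bigO_plus; [apply O_of_eps_mult; bigO | bigO].
Qed.

(** The derivatives of the fluxes, read off from the explicit right-hand sides in [X1E], [X2E],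
    [X3E]. *)
Definition X1d i := - sg i * V1 i - U1 i.
Definition X2d i := - sg i * U1 i + (Rg * T1 i / v i - Rg * th i * V1 i / v i ^ 2).
Definition X3d i :=
  - sg i * (Rg / (gamma - 1)) * T1 i + sg i * U i * U1 i + pm * U1 i.

(* Frozen at the left state, the derivative of the flux vector is a combination of w1 and w2
   alone: they vanish exactly on the kernel of the linearization. *)
Definition w1 i := a1 i + a2 i / ss.
Definition w2 i := Rg / pm * a3 i - (gamma - 1) * a2 i / ss.

Lemma X1d_w : bigO small (fun i => X1d i - - ss * w1 i) en.
Proof.
assert (N := ss_neq0).
apply (bigO_ext (fun i => - sg i * (V1 i - a1 i) - (U1 i - a2 i) - (sg i - ss) * a1 i)).
{ intros i; unfold X1d, w1; field; exact N. }
unfold en; bigO.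
Qed.

Lemma inv_v_1 : bigO small (fun i => / v i) (fun _ => 1).
Proof. apply (O_1_of_minus _ (/ vm)), inv_v_vm. Qed.

Lemma th_1 : bigO small th (fun _ => 1).
Proof. apply (O_1_of_minus _ thm), th_thm. Qed.

Lemma v_1 : bigO small v (fun _ => 1).
Proof. apply (O_1_of_minus _ vm), v_vm. Qed.

Hint Resolve U1_n inv_v_1 th_1 v_1 : bigO.

Lemma p_over_v : bigO small (fun i => Rg * th i * / v i * / v i - pm / vm) eps.
Proof.
apply (bigO_ext (fun i => (Rg * th i / v i) * / v i - pm * / vm)); [intros; unfold Rdiv; ring|].
apply bigO_mult_minus; [apply vanishing_eps | bigO | bigO].
Qed.

Hint Resolve p_over_v : bigO.

Lemma X2d_w : bigO small (fun i => X2d i - pm / vm * (w2 i - w1 i)) en.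
Proof.
assert (N := ss_neq0); assert (P := pm_pos).
apply (bigO_ext (fun i =>
   - sg i * (U1 i - a2 i) - (sg i - ss) * a2 i + Rg * / v i * (T1 i - a3 i)
   + Rg * (/ v i - / vm) * a3 i - Rg * th i * / v i * / v i * (V1 i - a1 i)
   - (Rg * th i * / v i * / v i - pm / vm) * a1 i)).
{ intros i; assert (A := v_pos i); unfold X2d, w1, w2.
  apply Rminus_diag_uniq.
  (* All terms match except this multiple of [a2], which vanishes because ss is an acoustic speed of
     the left state: ss ^ 2 * vm = gamma * pm. *)
  transitivity (a2 i * (ss - gamma * pm / (vm * ss)));
    [field | replace (gamma * pm) with (ss ^ 2 * vm) by exact hss; field]; repeat split; lra. }
unfold en; bigO.
Qed.

Lemma X3d_w : bigO small (fun i => X3d i - - ss * pm / (gamma - 1) * w2 i) en.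
Proof.
assert (N := ss_neq0); assert (P := pm_pos).
apply (bigO_ext (fun i =>
   - sg i * (Rg / (gamma - 1)) * (T1 i - a3 i) - (sg i - ss) * (Rg / (gamma - 1)) * a3 i
   + sg i * U i * U1 i + pm * (U1 i - a2 i))).
{ intros i; unfold X3d, w2; field; repeat split; lra. }
unfold en; bigO.
Qed.

Definition w1d i := d1 * X1d i + d2 * X2d i / ss.
Definition w2d i := Rg / pm * (d3 * X3d i) - (gamma - 1) * (d2 * X2d i) / ss.

(** [r1] and [r2] are the remainders of the closed 2 x 2 system which (w1, w2) satisfies when
    coefficients are frozen. *)
Definition r1 i := w1d i - - ss * (d1 * w1 i + d2 / gamma * (w1 i - w2 i)).
Definition r2 i :=
  w2d i - - ss * (d3 * Rg / (gamma - 1) * w2 i + (gamma - 1) * (d2 / gamma) * (w2 i - w1 i)).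

Lemma r1_en : bigO small r1 en.
Proof.
assert (N := ss_neq0); assert (P := pm_pos).
apply (bigO_ext (fun i => d1 * (X1d i - - ss * w1 i)
  + d2 / ss * (X2d i - pm / vm * (w2 i - w1 i)))).
{ intros i; unfold r1, w1d.
  apply Rminus_diag_uniq.
  transitivity (d2 * (w1 i - w2 i) / (gamma * vm * ss) * (gamma * pm - ss ^ 2 * vm));
   [field; repeat split; lra | rewrite hss; ring]. }
apply bigO_plus; apply bigO_scal; [apply X1d_w | apply X2d_w].
Qed.

Lemma r2_en : bigO small r2 en.
Proof.
assert (N := ss_neq0); assert (P := pm_pos).
apply (bigO_ext (fun i => Rg / pm * d3 * (X3d i - - ss * pm / (gamma - 1) * w2 i)
  + - ((gamma - 1) * d2 / ss) * (X2d i - pm / vm * (w2 i - w1 i)))).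
{ intros i; unfold r2, w2d.
  apply Rminus_diag_uniq.
  transitivity ((gamma - 1) * d2 * (w2 i - w1 i) / (gamma * vm * ss)
     * (gamma * pm - ss ^ 2 * vm));
   [field; repeat split; lra | rewrite hss; ring]. }
apply bigO_plus; apply bigO_scal; [apply X3d_w | apply X2d_w].
Qed.

(* [rewrite] does not see through the eta-expansions produced by [auto_derive]. *)
Ltac rewrite_derivatives :=
  repeat match goal with
  | |- context [Derive ?g ?x] =>
    match goal with
    | H : is_derive ?f x ?l |- _ =>
      replace (Derive g x) with l by (symmetry; exact (is_derive_unique f x l H))
    end
  end.

(** * Quadratic forms along the orbit and the cone condition *)

Lemma dX1 (w : wave) (x : R) : is_derive (fun y : R => X1 (w, y)) x (X1d (w, x)).
Proof.
apply (is_derive_ext (fun y => - wsg w * wV w y - wU w y));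
  [intros t; symmetry; apply X1E|].
assert (A := w_dV w x); assert (B := w_dU w x).
unfold X1d, sg, V1, U1; simpl.
auto_derive; [split; [eexists; exact A | split; [eexists; exact B | trivial]]|].
rewrite_derivatives; ring.
Qed.

Lemma dX2 (w : wave) (x : R) : is_derive (fun y : R => X2 (w, y)) x (X2d (w, x)).
Proof.
apply (is_derive_ext (fun y => - wsg w * wU w y + (Rg * (thm + wT w y) / (vm + wV w y) - pm)));
  [intros t; symmetry; apply X2E|].
assert (A := w_dV w x); assert (B := w_dU w x); assert (C := w_dT w x).
assert (P := w_v_pos w x).
unfold X2d, sg, V1, U1, T1, v, th, V, T; simpl.
auto_derive.
- repeat split; try (eexists; eassumption); lra.
- rewrite_derivatives.
  field; lra.
Qed.

Lemma dX3 (w : wave) (x : R) : is_derive (fun y : R => X3 (w, y)) x (X3d (w, x)).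
Proof.
apply (is_derive_ext (fun y => - wsg w * (Rg / (gamma - 1)) * wT w y
   + wsg w * wU w y ^ 2 / 2 + pm * wU w y));
  [intros t; symmetry; apply X3E|].
assert (B := w_dU w x); assert (C := w_dT w x).
unfold X3d, sg, U1, T1, U; simpl.
auto_derive.
- repeat split; eexists; eassumption.
- rewrite_derivatives.
  field; lra.
Qed.

Definition G i := (gamma - 1) * w1 i ^ 2 + w2 i ^ 2.
Definition Gd i := 2 * ((gamma - 1) * w1 i * w1d i + w2 i * w2d i).
(** A differentiable quantity equivalent to the square of [flux_norm]. *)
Definition M i := X1 i ^ 2 + X2 i ^ 2 + X3 i ^ 2.
Definition Md i := 2 * (X1 i * X1d i + X2 i * X2d i + X3 i * X3d i).

Lemma dM (w : wave) (x : R) : is_derive (fun y : R => M (w, y)) x (Md (w, x)).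
Proof.
assert (A := dX1 w x); assert (B := dX2 w x); assert (C := dX3 w x).
pose (f1 := fun y => X1 (w, y)); pose (f2 := fun y => X2 (w, y)); pose (f3 := fun y => X3 (w, y)).
change (is_derive (fun y => f1 y ^ 2 + f2 y ^ 2 + f3 y ^ 2) x (Md (w, x))).
change (is_derive f1 x (X1d (w, x))) in A; change (is_derive f2 x (X2d (w, x))) in B;
  change (is_derive f3 x (X3d (w, x))) in C.
auto_derive.
- repeat split; eexists; eassumption.
- rewrite_derivatives. unfold Md, f1, f2, f3.
ring.
Qed.

Lemma dG (w : wave) (x : R) : is_derive (fun y : R => G (w, y)) x (Gd (w, x)).
Proof.
assert (N := ss_neq0); assert (P := pm_pos).
assert (A := dX1 w x); assert (B := dX2 w x); assert (C := dX3 w x).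
pose (f1 := fun y => X1 (w, y)); pose (f2 := fun y => X2 (w, y)); pose (f3 := fun y => X3 (w, y)).
change (is_derive (fun y => (gamma - 1) * (d1 * f1 y + d2 * f2 y / ss) ^ 2
  + (Rg / pm * (d3 * f3 y) - (gamma - 1) * (d2 * f2 y) / ss) ^ 2) x (Gd (w, x))).
change (is_derive f1 x (X1d (w, x))) in A; change (is_derive f2 x (X2d (w, x))) in B;
  change (is_derive f3 x (X3d (w, x))) in C.
auto_derive.
- repeat split; eexists; eassumption.
- rewrite_derivatives; unfold Gd, w1, w2, w1d, w2d, a1, a2, a3, f1, f2, f3; field; lra.
Qed.

Lemma d1_pos : 0 < d1.
Proof. apply Rdiv_lt_0_compat; [lra | now apply htau]. Qed.
Lemma d2_pos : 0 < d2.
Proof. apply Rdiv_lt_0_compat; [lra | now apply hmu]. Qed.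
Lemma d3_pos : 0 < d3.
Proof. apply Rdiv_lt_0_compat; [lra | now apply hkappa]. Qed.

Lemma n_sq_M i : flux_norm i ^ 2 <= 3 * M i.
Proof.
unfold flux_norm, M.
rewrite <- (pow2_abs (X1 i)), <- (pow2_abs (X2 i)), <- (pow2_abs (X3 i)).
generalize (pow2_ge_0 (Rabs (X1 i) - Rabs (X2 i))) (pow2_ge_0 (Rabs (X1 i) - Rabs (X3 i)))
  (pow2_ge_0 (Rabs (X2 i) - Rabs (X3 i))); lra.
Qed.

Lemma M_n_sq i : M i <= flux_norm i ^ 2.
Proof.
unfold flux_norm, M.
rewrite <- (pow2_abs (X1 i)), <- (pow2_abs (X2 i)), <- (pow2_abs (X3 i)).
assert (A := Rabs_pos (X1 i)); assert (B := Rabs_pos (X2 i)); assert (C := Rabs_pos (X3 i)).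
nra.
Qed.

Lemma M_nonneg i : 0 <= M i.
Proof.
unfold M; generalize (pow2_ge_0 (X1 i)) (pow2_ge_0 (X2 i)) (pow2_ge_0 (X3 i)); lra.
Qed.

Lemma G_nonneg i : 0 <= G i.
Proof.
unfold G; apply Rplus_le_le_0_compat; [apply Rmult_le_pos; [lra|]|]; apply pow2_ge_0.
Qed.

Lemma young (l a b : R) : 0 < l -> 2 * (a * b) <= l * a ^ 2 + b ^ 2 / l.
Proof.
intros Hl; apply Rminus_le.
replace (2 * (a * b) - (l * a ^ 2 + b ^ 2 / l)) with (- (l * (a - b / l) ^ 2)) by (field; lra).
generalize (Rmult_le_pos _ _ (Rlt_le _ _ Hl) (pow2_ge_0 (a - b / l))); lra.
Qed.

Lemma bigO_sq f g :
  bigO small f g -> exists C, 0 < C /\ small (fun i => f i ^ 2 <= C * g i ^ 2).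
Proof.
intros (C & HC & H); exists (C ^ 2 + 1); split; [generalize (pow2_ge_0 C); lra|].
revert H; apply filter_imp; intros i H.
rewrite <- (pow2_abs (f i)), <- (pow2_abs (g i)).
assert (A := Rabs_pos (f i)).
apply Rle_trans with ((C * Rabs (g i)) ^ 2); [apply pow_incr; lra|].
generalize (pow2_ge_0 (Rabs (g i))); nra.
Qed.

(* The frozen part of the system for (w1, w2) is, up to the factor - ss, positive definite for
   the quadratic form G; this is the spectral gap of the two fast directions. *)
Lemma G_growth :
  exists l C, 0 < l /\ 0 < C /\
    small (fun i => l * G i - C * (eps i ^ 2 * M i) <= - ss * Gd i).
Proof.
assert (N := ss_neq0); assert (P := pm_pos).
assert (D1 := d1_pos); assert (D2 := d2_pos); assert (D3 := d3_pos).
assert (S : 0 < ss ^ 2) by (apply pow2_gt_0; exact N).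
(* A lower bound for the spectral gap: the square of w1 - w2 is dropped and the two diagonal terms
   are kept. *)
pose (m := Rmin d1 (d3 * Rg / (gamma - 1))).
assert (D3' : 0 < d3 * Rg / (gamma - 1)) by (apply Rdiv_lt_0_compat; nra).
assert (Hm : 0 < m) by (apply Rmin_pos; assumption).
assert (Hm1 : m <= d1) by apply Rmin_l.
assert (Hm2 : m <= d3 * Rg / (gamma - 1)) by apply Rmin_r.
assert (Hl : 0 < ss ^ 2 * m) by (apply Rmult_lt_0_compat; assumption).
destruct (bigO_sq _ _ r1_en) as (C1 & HC1 & H1).
destruct (bigO_sq _ _ r2_en) as (C2 & HC2 & H2).
exists (ss ^ 2 * m), (3 * (((gamma - 1) * C1 + C2) / m)); split; [exact Hl|]; split.
{ apply Rmult_lt_0_compat; [lra|]; apply Rdiv_lt_0_compat; [|exact Hm].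
  apply Rplus_lt_0_compat; [apply Rmult_lt_0_compat|]; lra. }
generalize (filter_and _ _ H1 H2); apply filter_imp; intros i [A B].
replace (- ss * Gd i) with
  (2 * ss ^ 2 * ((gamma - 1) * d1 * w1 i ^ 2 + d3 * Rg / (gamma - 1) * w2 i ^ 2
     + (gamma - 1) * (d2 / gamma) * (w1 i - w2 i) ^ 2)
   - (gamma - 1) * (2 * (w1 i * (ss * r1 i))) - 2 * (w2 i * (ss * r2 i)))
  by (unfold Gd, r1, r2; field; lra).
assert (Y1 := young (ss ^ 2 * m) (w1 i) (ss * r1 i) Hl).
assert (Y2 := young (ss ^ 2 * m) (w2 i) (ss * r2 i) Hl).
replace ((ss * r1 i) ^ 2 / (ss ^ 2 * m)) with (r1 i ^ 2 / m) in Y1 by (field; lra).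
replace ((ss * r2 i) ^ 2 / (ss ^ 2 * m)) with (r2 i ^ 2 / m) in Y2 by (field; lra).
assert (E : en i ^ 2 <= 3 * (eps i ^ 2 * M i)).
{ unfold en; rewrite Rpow_mult_distr.
  generalize (Rmult_le_compat_l _ _ _ (pow2_ge_0 (eps i)) (n_sq_M i)); lra. }
assert (im : 0 < / m) by (now apply Rinv_0_lt_compat).
assert (Z1 : r1 i ^ 2 / m <= C1 * (3 * (eps i ^ 2 * M i)) / m).
{ apply Rmult_le_compat_r; [lra|]; eapply Rle_trans; [exact A|].
  apply Rmult_le_compat_l; lra. }
assert (Z2 : r2 i ^ 2 / m <= C2 * (3 * (eps i ^ 2 * M i)) / m).
{ apply Rmult_le_compat_r; [lra|]; eapply Rle_trans; [exact B|].
  apply Rmult_le_compat_l; lra. }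
assert (W1 := pow2_ge_0 (w1 i)); assert (W2 := pow2_ge_0 (w2 i)).
assert (G1 : 2 * (ss ^ 2 * m * G i) <= 2 * ss ^ 2 * ((gamma - 1) * d1 * w1 i ^ 2
  + d3 * Rg / (gamma - 1) * w2 i ^ 2 + (gamma - 1) * (d2 / gamma) * (w1 i - w2 i) ^ 2)).
{ replace (2 * (ss ^ 2 * m * G i)) with (2 * ss ^ 2 * (m * G i)) by ring.
  apply Rmult_le_compat_l; [lra|]; unfold G.
  assert (0 <= (gamma - 1) * (d2 / gamma) * (w1 i - w2 i) ^ 2).
  { apply Rmult_le_pos; [|apply pow2_ge_0].
    apply Rmult_le_pos; [lra|]. left; apply Rdiv_lt_0_compat; lra. }
  assert (m * ((gamma - 1) * w1 i ^ 2) <= (gamma - 1) * d1 * w1 i ^ 2).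
  { replace ((gamma - 1) * d1 * w1 i ^ 2) with (d1 * ((gamma - 1) * w1 i ^ 2)) by ring.
    apply Rmult_le_compat_r; [apply Rmult_le_pos|]; lra. }
  assert (m * w2 i ^ 2 <= d3 * Rg / (gamma - 1) * w2 i ^ 2)
    by (apply Rmult_le_compat_r; lra).
  lra. }
assert (K1 : 0 < gamma - 1) by lra.
assert (Y1' := Rmult_le_compat_l _ _ _ (Rlt_le _ _ K1)
  (Rle_trans _ _ _ Y1 (Rplus_le_compat_l _ _ _ Z1))).
replace (3 * (((gamma - 1) * C1 + C2) / m) * (eps i ^ 2 * M i)) with
  ((gamma - 1) * (C1 * (3 * (eps i ^ 2 * M i)) / m) + C2 * (3 * (eps i ^ 2 * M i)) / m)
  by (field; lra).
replace (ss ^ 2 * m * G i) with (2 * (ss ^ 2 * m * G i)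
   - (gamma - 1) * (ss ^ 2 * m * w1 i ^ 2) - ss ^ 2 * m * w2 i ^ 2) by (unfold G; ring).
lra.
Qed.

(** The fast components together with the freezing error: the size of the derivative of the flux
    vector. *)
Let q i := Rabs (w1 i) + Rabs (w2 i) + Rabs (en i).

Lemma q_nonneg i : 0 <= q i.
Proof.
unfold q; generalize (Rabs_pos (w1 i)) (Rabs_pos (w2 i)) (Rabs_pos (en i)); lra.
Qed.

Lemma w1_q : bigO small w1 q.
Proof.
apply (bigO_of_le _ _ 1); intros i; rewrite (Rabs_pos_eq (q i)) by apply q_nonneg; unfold q.
generalize (Rabs_pos (w2 i)) (Rabs_pos (en i)); lra.
Qed.

Lemma w2_q : bigO small w2 q.
Proof.
apply (bigO_of_le _ _ 1); intros i; rewrite (Rabs_pos_eq (q i)) by apply q_nonneg; unfold q.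
generalize (Rabs_pos (w1 i)) (Rabs_pos (en i)); lra.
Qed.

Lemma en_q : bigO small en q.
Proof.
apply (bigO_of_le _ _ 1); intros i; rewrite (Rabs_pos_eq (q i)) by apply q_nonneg; unfold q.
generalize (Rabs_pos (w1 i)) (Rabs_pos (w2 i)); lra.
Qed.

(** The kernel component of the fluxes does not drive their derivatives, so [Md] is O([flux_norm] *
    [q]) rather than O([flux_norm] ^ 2). This gain makes the correction term in [cone] change slowly
    enough. *)
Lemma M_growth :
  exists C, 0 < C /\
    small (fun i => Rabs (eps i ^ 2 * Md i) <= C * Rabs (eps i) * (G i + eps i ^ 2 * M i)).
Proof.
assert (w12 : bigO small (fun i => pm / vm * (w2 i - w1 i)) q)
  by (apply bigO_scal, bigO_minus; [apply w2_q | apply w1_q]).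
assert (H1 : bigO small X1d q).
{ apply (bigO_ext (fun i => (X1d i - - ss * w1 i) + - ss * w1 i)); [intros; ring|].
  apply bigO_plus; [apply (bigO_trans _ _ _ X1d_w en_q) | apply bigO_scal, w1_q]. }
assert (H2 : bigO small X2d q).
{ apply (bigO_ext (fun i => (X2d i - pm / vm * (w2 i - w1 i)) + pm / vm * (w2 i - w1 i)));
    [intros; ring|].
  apply bigO_plus; [apply (bigO_trans _ _ _ X2d_w en_q) | exact w12]. }
assert (H3 : bigO small X3d q).
{ apply (bigO_ext (fun i => (X3d i - - ss * pm / (gamma - 1) * w2 i)
    + - ss * pm / (gamma - 1) * w2 i)); [intros; ring|].
  apply bigO_plus; [apply (bigO_trans _ _ _ X3d_w en_q) | apply bigO_scal, w2_q]. }
assert (H : bigO small Md (fun i => flux_norm i * q i)).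
{ unfold Md; apply bigO_scal; repeat apply bigO_plus; apply bigO_mult; bigO || assumption. }
destruct H as (C & HC & H).
assert (K : 0 < / (gamma - 1)) by (apply Rinv_0_lt_compat; lra).
exists ((C + 1) * 3 * (/ (gamma - 1) + 4)); split.
{ apply Rmult_lt_0_compat; lra. }
revert H; apply filter_imp; intros i H.
assert (Q := q_nonneg i); assert (N := flux_norm_nonneg i).
assert (GP := G_nonneg i); assert (MP := M_nonneg i).
assert (E := Rabs_pos (eps i)).
rewrite Rabs_mult, (Rabs_pos_eq (eps i ^ 2)) by apply pow2_ge_0.
rewrite (Rabs_pos_eq (flux_norm i * q i)) in H by (now apply Rmult_le_pos).
assert (En : Rabs (eps i) * flux_norm i <= q i).
{ unfold q, en; rewrite (Rabs_mult (eps i)), (Rabs_pos_eq (flux_norm i)) by exact N.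
  generalize (Rabs_pos (w1 i)) (Rabs_pos (w2 i)); lra. }
assert (Q2 : q i ^ 2 <= 3 * (/ (gamma - 1) + 4) * (G i + eps i ^ 2 * M i)).
{ apply Rle_trans with (3 * (w1 i ^ 2 + w2 i ^ 2 + en i ^ 2)).
  { unfold q; rewrite <- (pow2_abs (w1 i)), <- (pow2_abs (w2 i)), <- (pow2_abs (en i)).
    generalize (pow2_ge_0 (Rabs (w1 i) - Rabs (w2 i))) (pow2_ge_0 (Rabs (w1 i) - Rabs (en i)))
     (pow2_ge_0 (Rabs (w2 i) - Rabs (en i))); lra. }
  rewrite Rmult_assoc; apply Rmult_le_compat_l; [lra|].
  assert (e1 : en i ^ 2 <= 3 * (eps i ^ 2 * M i)).
  { unfold en; rewrite Rpow_mult_distr.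
    generalize (Rmult_le_compat_l _ _ _ (pow2_ge_0 (eps i)) (n_sq_M i)); lra. }
  assert (e2 : 0 <= eps i ^ 2 * M i) by (apply Rmult_le_pos; [apply pow2_ge_0 | exact MP]).
  assert (e3 : w1 i ^ 2 + w2 i ^ 2 <= (/ (gamma - 1) + 1) * G i).
  { unfold G.
    replace ((/ (gamma - 1) + 1) * ((gamma - 1) * w1 i ^ 2 + w2 i ^ 2)) with
      (w1 i ^ 2 + w2 i ^ 2 + (gamma - 1) * w1 i ^ 2 + / (gamma - 1) * w2 i ^ 2) by (field; lra).
    assert (0 <= (gamma - 1) * w1 i ^ 2) by (apply Rmult_le_pos; [lra | apply pow2_ge_0]).
    assert (0 <= / (gamma - 1) * w2 i ^ 2) by (apply Rmult_le_pos; [lra | apply pow2_ge_0]).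
    lra. }
  assert (0 <= / (gamma - 1) * (eps i ^ 2 * M i)) by (apply Rmult_le_pos; lra).
  lra. }
(* Of the two factors eps, one stays in front and the other turns [flux_norm] into [en], which is at
   most [q]. *)
apply Rle_trans with (eps i ^ 2 * ((C + 1) * (flux_norm i * q i))).
{ apply Rmult_le_compat_l; [apply pow2_ge_0|].
  assert (0 <= flux_norm i * q i) by (now apply Rmult_le_pos); lra. }
rewrite <- (pow2_abs (eps i)).
replace (Rabs (eps i) ^ 2 * ((C + 1) * (flux_norm i * q i))) with
  ((C + 1) * Rabs (eps i) * (Rabs (eps i) * flux_norm i * q i)) by ring.
rewrite pow2_abs.
replace ((C + 1) * 3 * (/ (gamma - 1) + 4) * Rabs (eps i) * (G i + eps i ^ 2 * M i)) with
  ((C + 1) * Rabs (eps i) * (3 * (/ (gamma - 1) + 4) * (G i + eps i ^ 2 * M i))) by ring.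
apply Rmult_le_compat_l; [apply Rmult_le_pos; lra|].
apply Rle_trans with (q i ^ 2); [|exact Q2].
simpl; rewrite Rmult_1_r; apply Rmult_le_compat_r; assumption.
Qed.

Lemma G_1 : bigO small G (fun _ => 1).
Proof.
assert (A1 : bigO small a1 (fun _ => 1)) by (apply O_eps_1, bigO_scal, X1_eps).
assert (A2 : bigO small a2 (fun _ => 1)) by (apply O_eps_1, bigO_scal, X2_eps).
assert (A3 : bigO small a3 (fun _ => 1)) by (apply O_eps_1, bigO_scal, X3_eps).
assert (W1 : bigO small w1 (fun _ => 1)) by (unfold w1, Rdiv; bigO).
assert (W2 : bigO small w2 (fun _ => 1)) by (unfold w2, Rdiv; bigO).
apply (bigO_ext (fun i => (gamma - 1) * w1 i * w1 i + w2 i * w2 i)); [|bigO].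
intros; unfold G; ring.
Qed.

(* The function G - K eps^2 M grows exponentially in one of the two directions of time as soon
   as it is positive, which a bounded orbit does not allow. *)
Lemma cone : exists K, 0 < K /\ small (fun i => G i <= K * (eps i ^ 2 * M i)).
Proof.
destruct G_growth as (l & C & Hl & HC & H1).
destruct M_growth as (D & HD & H2).
destruct G_1 as (B & HB & H3).
assert (N := ss_neq0); assert (SP := Rabs_pos_lt _ N).
(* Then l / 2 * K = 2 * C: one C covers the defect in [G_growth], the other the contribution of eps
   ^ 2 * [Md]. *)
pose (K := 4 * C / l).
assert (HK : 0 < K) by (apply Rdiv_lt_0_compat; lra).
exists K; split; [exact HK|].
assert (KD : 0 < K * D * Rabs ss).
{ apply Rmult_lt_0_compat; [apply Rmult_lt_0_compat|]; assumption. }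
(* Below this strength the derivative of the correction costs at most half of the growth rate of G
   and one C of eps ^ 2 * [M]. *)
assert (H4 : small (fun i => K * D * Rabs ss * Rabs (eps i) <= Rmin (l / 2) C)).
{ generalize (vanishing_eps (Rmin (l / 2) C / (K * D * Rabs ss))
    ltac:(apply Rdiv_lt_0_compat; [apply Rmin_pos; lra | exact KD])).
  apply filter_imp; intros i H.
  apply (Rmult_le_compat_l _ _ _ (Rlt_le _ _ KD)) in H.
  eapply Rle_trans; [exact H|]; apply Req_le; field; repeat split; lra. }
destruct (filter_and _ _ (filter_and _ _ H1 H2) (filter_and _ _ H3 H4)) as (e0 & He0 & H).
exists e0; split; [exact He0|]; intros w x Hw.
assert (HQ := bounded_growth_nonpos (fun y => G (w, y) - K * wVp w ^ 2 * M (w, y))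
  (fun y => Gd (w, y) - K * wVp w ^ 2 * Md (w, y)) (- ss) (l / 2) (B * 1)).
cbv beta in HQ.
assert (Z : G (w, x) - K * wVp w ^ 2 * M (w, x) <= 0).
2:{ unfold eps; simpl fst; lra. }
apply HQ; clear HQ x.
- lra.
- lra.
- intros x; apply (is_derive_minus (fun y => G (w, y)) (fun y => K * wVp w ^ 2 * M (w, y))).
  + apply dG.
  + apply is_derive_scal, dM.
- intros x; destruct (H w x Hw) as [[A1 A2] [_ A4]].
  unfold eps in *; simpl fst in *.
  set (g := G (w, x)) in *; set (m := wVp w ^ 2 * M (w, x)) in *.
  assert (gp : 0 <= g) by apply G_nonneg.
  assert (mp : 0 <= m) by (apply Rmult_le_pos; [apply pow2_ge_0 | apply M_nonneg]).
  assert (A5 : - (K * (D * Rabs (wVp w) * (g + m)) * Rabs ss)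
     <= ss * (K * (wVp w ^ 2 * Md (w, x)))).
  { set (md := wVp w ^ 2 * Md (w, x)) in *.
    apply Rle_trans with (- Rabs (ss * (K * md))).
    - rewrite !Rabs_mult, (Rabs_pos_eq K) by lra.
      apply Ropp_le_contravar; rewrite Rmult_comm.
      apply Rmult_le_compat_r; [lra|]; apply Rmult_le_compat_l; lra.
    - generalize (Rle_abs (- (ss * (K * md)))); rewrite Rabs_Ropp; lra. }
  replace (K * (D * Rabs (wVp w) * (g + m)) * Rabs ss)
    with (K * D * Rabs ss * Rabs (wVp w) * (g + m)) in A5 by ring.
  assert (A6 : K * D * Rabs ss * Rabs (wVp w) * (g + m) <= l / 2 * g + C * m).
  { assert (K * D * Rabs ss * Rabs (wVp w) * g <= l / 2 * g)
      by (apply Rmult_le_compat_r; [exact gp|]; eapply Rle_trans; [exact A4 | apply Rmin_l]).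
    assert (K * D * Rabs ss * Rabs (wVp w) * m <= C * m)
      by (apply Rmult_le_compat_r; [exact mp|]; eapply Rle_trans; [exact A4 | apply Rmin_r]).
    lra. }
  replace (l / 2 * (g - K * wVp w ^ 2 * M (w, x))) with (l / 2 * g - 2 * C * m)
    by (unfold K, m; field; lra).
  lra.
- intros x; destruct (H w x Hw) as [_ [A3 _]].
  rewrite Rabs_R1, Rabs_pos_eq in A3 by apply G_nonneg.
  assert (0 <= K * wVp w ^ 2 * M (w, x)).
  { apply Rmult_le_pos; [apply Rmult_le_pos; [lra | apply pow2_ge_0] | apply M_nonneg]. }
  lra.
Qed.

Lemma w_en : bigO small w1 en /\ bigO small w2 en.
Proof.
destruct cone as (K & HK & H).
assert (Q : 0 < gamma - 1) by lra.
assert (Z : forall (y e k : R), 0 <= k -> y ^ 2 <= k * e ^ 2 -> Rabs y <= (k + 1) * Rabs e).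
{ intros y e k Hk Hy; rewrite <- (Rabs_pos_eq (k + 1)), <- Rabs_mult by lra.
  apply Rsqr_le_abs_0; unfold Rsqr; generalize (pow2_ge_0 e); nra. }
assert (E : forall i, eps i ^ 2 * M i <= en i ^ 2).
{ intros i; unfold en; rewrite Rpow_mult_distr.
  apply Rmult_le_compat_l; [apply pow2_ge_0 | apply M_n_sq]. }
split.
- exists (K / (gamma - 1) + 1); split.
  { assert (0 < K / (gamma - 1)) by (apply Rdiv_lt_0_compat; lra); lra. }
  revert H; apply filter_imp; intros i H; apply Z.
  { left; apply Rdiv_lt_0_compat; lra. }
  apply Rmult_le_reg_l with (gamma - 1); [lra|].
  replace ((gamma - 1) * (K / (gamma - 1) * en i ^ 2)) with (K * en i ^ 2) by (field; lra).
  assert (A := Rmult_le_compat_l _ _ _ (Rlt_le _ _ HK) (E i)).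
  unfold G in H; generalize (pow2_ge_0 (w2 i)); lra.
- exists (K + 1); split; [lra|].
  revert H; apply filter_imp; intros i H; apply Z; [lra|].
  assert (A := Rmult_le_compat_l _ _ _ (Rlt_le _ _ HK) (E i)).
  assert (0 <= (gamma - 1) * w1 i ^ 2) by (apply Rmult_le_pos; [lra | apply pow2_ge_0]).
  unfold G in H; lra.
Qed.

(** * Slaving of all derivatives to [V1] *)

Let eV i := eps i * V1 i.

(** With w1 and w2 of size [en], the derivative is nearly parallel to the kernel vector (1, - ss, -
    (gamma - 1) * pm / Rg); this lemma and [T1_slaved_n] give its last two entries. *)
Lemma U1_slaved_n : bigO small (fun i => U1 i + ss * V1 i) en.
Proof.
assert (N := ss_neq0).
apply (bigO_ext (fun i => ss * w1 i + (U1 i - a2 i) + ss * (V1 i - a1 i))).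
{ intros i; unfold w1; field; exact N. }
destruct w_en as [H _]; bigO.
Qed.

Lemma T1_slaved_n : bigO small (fun i => T1 i + (gamma - 1) * pm / Rg * V1 i) en.
Proof.
assert (N := ss_neq0); assert (P := pm_pos).
apply (bigO_ext (fun i => pm / Rg * (w2 i + (gamma - 1) * w1 i) + (T1 i - a3 i)
   + (gamma - 1) * pm / Rg * (V1 i - a1 i))).
{ intros i; unfold w1, w2; field; lra. }
destruct w_en as [H H']; bigO.
Qed.

Lemma coef_1 f : positive_C2 f -> bigO small (fun i => f (th i)) (fun _ => 1).
Proof. intros Hf; apply (O_1_of_minus _ (f thm)), (coef_near f Hf). Qed.

Lemma inv_coef_1 f : positive_C2 f -> bigO small (fun i => / f (th i)) (fun _ => 1).
Proof. intros Hf; apply (O_1_of_minus _ (/ f thm)), (inv_coef_near f Hf). Qed.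

Lemma flux_O f (Y g : J -> R) :
  positive_C2 f -> bigO small Y g -> bigO small (flux f Y) g.
Proof.
intros Hf HY; unfold flux, Rdiv; apply bigO_mult_r; [now apply coef_1|].
apply bigO_mult_l; [exact HY | apply inv_v_1].
Qed.

(** U1 and T1 are multiples of V1 up to eps * [flux_norm], and that error is absorbed. Afterwards
    every error [en] may be read as eps * V1. *)
Lemma n_V1 : bigO small flux_norm V1.
Proof.
apply (bigO_absorb _ _ eps vanishing_eps).
assert (HV : bigO small V1 (fun i => Rabs (V1 i) + Rabs (eps i * flux_norm i)))
  by apply bigO_sum_l.
assert (He : forall g, bigO small g en ->
    bigO small g (fun i => Rabs (V1 i) + Rabs (eps i * flux_norm i))).
{ intros g Hg; apply (bigO_trans _ _ _ Hg), bigO_sum_r. }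
assert (HU : bigO small U1 (fun i => Rabs (V1 i) + Rabs (eps i * flux_norm i))).
{ apply (bigO_ext (fun i => (U1 i + ss * V1 i) - ss * V1 i)); [intros; ring|].
  apply bigO_minus; [apply He, U1_slaved_n | now apply bigO_scal]. }
assert (HT : bigO small T1 (fun i => Rabs (V1 i) + Rabs (eps i * flux_norm i))).
{ apply (bigO_ext (fun i => (T1 i + (gamma - 1) * pm / Rg * V1 i)
    - (gamma - 1) * pm / Rg * V1 i)); [intros; ring|].
  apply bigO_minus; [apply He, T1_slaved_n | now apply bigO_scal]. }
unfold flux_norm at 1; repeat apply bigO_plus; apply bigO_Rabs; now apply flux_O.
Qed.

Lemma en_eV : bigO small en eV.
Proof. apply bigO_mult; [apply bigO_refl | apply n_V1]. Qed.

Lemma U1_slaved : bigO small (fun i => U1 i + ss * V1 i) eV.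
Proof. apply (bigO_trans _ _ _ U1_slaved_n en_eV). Qed.

Lemma T1_slaved : bigO small (fun i => T1 i + (gamma - 1) * pm / Rg * V1 i) eV.
Proof. apply (bigO_trans _ _ _ T1_slaved_n en_eV). Qed.

Lemma X_V1 : bigO small X1 V1 /\ bigO small X2 V1 /\ bigO small X3 V1.
Proof.
repeat split; (eapply bigO_trans; [|exact n_V1]); [apply X1_n | apply X2_n | apply X3_n].
Qed.

Lemma U1_V1 : bigO small U1 V1.
Proof. apply (bigO_trans _ _ _ U1_n n_V1). Qed.

Lemma T1_V1 : bigO small T1 V1.
Proof.
apply (bigO_ext (fun i => (T1 i - a3 i) + a3 i)); [intros; ring|].
apply (fun H => bigO_trans _ _ _ H n_V1).
apply bigO_plus; [apply O_of_eps_mult; bigO | bigO].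
Qed.

Lemma V1_eps : bigO small V1 eps.
Proof.
apply (bigO_ext (fun i => v i * / tau (th i) * X1 i)).
{ intros i; symmetry; now apply flux_inv. }
apply bigO_mult_r; [apply bigO_mult_r|]; [apply v_1 | now apply inv_coef_1 | apply X1_eps].
Qed.

Lemma Xd_eV : bigO small X1d eV /\ bigO small X2d eV /\ bigO small X3d eV.
Proof.
assert (N := ss_neq0).
destruct w_en as [H1 H2].
repeat split; (eapply bigO_trans; [|exact en_eV]).
- apply (bigO_ext (fun i => (X1d i - - ss * w1 i) + - ss * w1 i)); [intros; ring|].
  apply bigO_plus; [apply X1d_w | now apply bigO_scal].
- apply (bigO_ext (fun i => (X2d i - pm / vm * (w2 i - w1 i)) + pm / vm * (w2 i - w1 i)));
    [intros; ring|].
  apply bigO_plus; [apply X2d_w | now apply bigO_scal, bigO_minus].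
- apply (bigO_ext (fun i => (X3d i - - ss * pm / (gamma - 1) * w2 i)
    + - ss * pm / (gamma - 1) * w2 i)); [intros; ring|].
  apply bigO_plus; [apply X3d_w | now apply bigO_scal].
Qed.

(** The flux is differentiated in two ways, through the integrated equation ([Xd]) and by the
    product rule; uniqueness of the derivative then solves for [Y2]. This is where f' enters,
    multiplied by T1 = O(eps). *)
Lemma second_derivative f (Y Y2 Xd : J -> R) :
  positive_C2 f ->
  (forall w (x : R), is_derive (fun y : R => Y (w, y)) x (Y2 (w, x))) ->
  (forall w (x : R), is_derive (fun y : R => flux f Y (w, y)) x (Xd (w, x))) ->
  bigO small Y V1 -> bigO small Xd eV -> bigO small Y2 eV.
Proof.
intros Hf HY HX O1 O2.
apply (bigO_ext (fun i =>
  v i * / f (th i) * Xd i - Derive f (th i) * / f (th i) * T1 i * Y i + / v i * V1 i * Y i)).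
- intros [w x].
  assert (fp : 0 < f (th (w, x))) by (apply Hf, th_pos).
  assert (vp := v_pos (w, x)).
  assert (D : is_derive (fun y : R => flux f Y (w, y)) x
    (Derive f (th (w, x)) * T1 (w, x) * (Y (w, x) / v (w, x))
     + f (th (w, x)) * (Y2 (w, x) / v (w, x) - Y (w, x) * V1 (w, x) / v (w, x) ^ 2))).
  { assert (A := HY w x); assert (B := w_dV w x); assert (C := w_dT w x).
    assert (E := proj1 (C2_derivatives f _ _ (proj2 Hf) (th_pos (w, x)))).
    pose (y1 := fun y => Y (w, y)).
    change (is_derive (fun y => f (thm + wT w y) * (y1 y / (vm + wV w y))) x
      (Derive f (thm + wT w x) * wT1 w x * (y1 x / (vm + wV w x))
        + f (thm + wT w x) * (Y2 (w, x) / (vm + wV w x)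
          - y1 x * wV1 w x / (vm + wV w x) ^ 2))).
    change (is_derive y1 x (Y2 (w, x))) in A.
    change (0 < vm + wV w x) in vp.
    change (is_derive f (thm + wT w x) (Derive f (thm + wT w x))) in E.
    set (df := Derive f (thm + wT w x)) in *; clearbody df.
    auto_derive.
    - repeat split; try (eexists; eassumption); lra.
    - rewrite_derivatives; field; lra. }
  assert (U0 := eq_trans (eq_sym (is_derive_unique _ _ _ (HX w x))) (is_derive_unique _ _ _ D)).
  rewrite U0; field; lra.
- assert (I1 := inv_coef_1 f Hf); destruct (coef_near f Hf) as [_ I2].
  assert (I3 := V1_eps); assert (I4 := O_eps_1 _ (bigO_trans _ _ _ T1_V1 V1_eps)).
  assert (I5 := bigO_trans _ _ _ T1_V1 V1_eps).
  apply bigO_plus; [apply bigO_minus|].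
  + apply bigO_mult_r; [bigO | exact O2].
  + apply bigO_mult; [|exact O1]. bigO.
  + apply bigO_mult; [|exact O1]. bigO.
Qed.

Lemma V2_eV : bigO small V2 eV.
Proof.
apply (second_derivative tau V1 V2 X1d htau); [apply w_dV1 | apply dX1 | apply bigO_refl | apply Xd_eV].
Qed.

Lemma U2_eV : bigO small U2 eV.
Proof.
apply (second_derivative mu U1 U2 X2d hmu); [apply w_dU1 | apply dX2 | apply U1_V1 | apply Xd_eV].
Qed.

Lemma T2_eV : bigO small T2 eV.
Proof.
apply (second_derivative kappa T1 T2 X3d hkappa);
  [apply w_dT1 | apply dX3 | apply T1_V1 | apply Xd_eV].
Qed.

(** * The reduced scalar equation for V *)

Definition Q i := V i * (eps i - V i).

Definition A : R :=
  Rg * gamma * ss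
    / (Rg * tau thm + Rg * gamma * mu thm + (gamma - 1) ^ 2 * kappa thm)
    * ((gamma + 1) / 2).

Lemma denominator_pos :
  0 < Rg * tau thm + Rg * gamma * mu thm + (gamma - 1) ^ 2 * kappa thm.
Proof.
assert (0 < tau thm) by now apply htau.
assert (0 < mu thm) by now apply hmu.
assert (0 < kappa thm) by now apply hkappa.
assert (0 < (gamma - 1) ^ 2) by (apply pow2_gt_0; lra).
repeat apply Rplus_lt_0_compat; repeat apply Rmult_lt_0_compat; lra.
Qed.

(* Eliminating U and T from the three flux equations; by the Rankine-Hugoniot relation for
   the speed, the terms without a flux are exactly quadratic in V and vanish at both ends. *)
Lemma flux_identity i :
  sg i * v i * X2 i + (gamma - 1) * X3 i - X1 i * (sg i ^ 2 * vm - (gamma - 1) * pm)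
    - gamma * sg i ^ 2 * V i * X1 i - (gamma - 1) * sg i * X1 i ^ 2 / 2
  = - sg i ^ 3 * ((gamma + 1) / 2) * Q i.
Proof.
assert (E := w_speed (fst i)); fold (sg i) (eps i) in E.
assert (vp := v_pos i).
assert (A2 : v i * X2 i = - sg i * U i * v i + Rg * T i - pm * V i).
{ rewrite X2E.
  transitivity (- sg i * U i * v i + (Rg * thm + Rg * T i) - pm * v i);
    [unfold th; field; lra | rewrite <- hpm; unfold v; ring]. }
assert (A1 : U i = - sg i * V i - X1 i) by (rewrite X1E; ring).
(* The weights sg and gamma - 1 are those for which sg * Rg * T cancels between v * X2 and X3; U is
   eliminated through X1. *)
transitivity (V i * sg i * (sg i ^ 2 * vm - gamma * pm) + sg i ^ 3 * V i ^ 2 * ((gamma + 1) / 2)).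
- replace (sg i * v i * X2 i) with (sg i * (v i * X2 i)) by ring.
  rewrite A2, X3E, A1; unfold v; field; lra.
- rewrite <- E; unfold Q; field.
Qed.

Lemma flux_frozen_inv f (Y : J -> R) :
  positive_C2 f ->
  bigO small (fun i => flux f Y i - f thm / vm * Y i) (fun i => eps i * Y i).
Proof.
intros Hf.
apply (bigO_ext (fun i => f (th i) * / v i * Y i - f thm * / vm * Y i)).
{ intros i; unfold flux, Rdiv; ring. }
apply bigO_freeze, bigO_mult_minus; [apply vanishing_eps | now apply coef_near | apply inv_v_vm].
Qed.

Lemma X1_frozen : bigO small (fun i => X1 i - tau thm / vm * V1 i) eV.
Proof. now apply flux_frozen_inv. Qed.

Lemma vX2_frozen : bigO small (fun i => v i * X2 i + mu thm * ss * V1 i) eV.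
Proof.
apply (bigO_ext (fun i => (mu (th i) - mu thm) * U1 i + mu thm * (U1 i + ss * V1 i))).
{ intros i; assert (vp := v_pos i); unfold X2, flux; field; lra. }
apply bigO_plus; [apply bigO_mult | apply bigO_scal, U1_slaved].
- now apply coef_near.
- apply U1_V1.
Qed.

Lemma X3_frozen :
  bigO small (fun i => X3 i + kappa thm / vm * ((gamma - 1) * pm / Rg) * V1 i) eV.
Proof.
apply (bigO_ext (fun i => (X3 i - kappa thm / vm * T1 i)
  + kappa thm / vm * (T1 i + (gamma - 1) * pm / Rg * V1 i))); [intros; ring|].
apply bigO_plus; [|apply bigO_scal, T1_slaved].
apply (bigO_trans _ (fun i => eps i * T1 i)); [now apply flux_frozen_inv|].
apply bigO_mult; [apply bigO_refl | apply T1_V1].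
Qed.

Lemma sg_sq : bigO small (fun i => sg i ^ 2 - ss ^ 2) eps.
Proof.
apply (bigO_ext (fun i => sg i * sg i - ss * ss)); [intros; ring|].
apply bigO_mult_minus; [apply vanishing_eps | bigO | bigO].
Qed.

Lemma sg_cube : bigO small (fun i => sg i ^ 3 - ss ^ 3) eps.
Proof.
apply (bigO_ext (fun i => sg i ^ 2 * sg i - ss ^ 2 * ss)); [intros; ring|].
apply bigO_mult_minus; [apply vanishing_eps | apply sg_sq | bigO].
Qed.

(** Each flux in [flux_identity] is replaced by its frozen multiple of V1. By ss ^ 2 * vm = gamma *
    pm the total coefficient of V1 is - pm * den / (Rg * vm), hence the prefactor below. The bound
    still contains eps * V1, since V1 is not yet controlled by Q. *)
Lemma V1_AQ_weak :
  bigO small (fun i => V1 i - A * Q i) (fun i => Rabs (eps i * Q i) + Rabs (eps i * V1 i)).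
Proof.
assert (P := pm_pos); assert (N := ss_neq0); assert (DP := denominator_pos).
set (den := Rg * tau thm + Rg * gamma * mu thm + (gamma - 1) ^ 2 * kappa thm) in *.
assert (S2 : ss ^ 2 = gamma * pm / vm) by (rewrite <- hss; field; lra).
apply (bigO_ext (fun i => Rg * vm / (pm * den) *
  (sg i * (v i * X2 i + mu thm * ss * V1 i) - (sg i - ss) * (mu thm * ss * V1 i)
   + (gamma - 1) * (X3 i + kappa thm / vm * ((gamma - 1) * pm / Rg) * V1 i)
   - (sg i ^ 2 * vm - (gamma - 1) * pm) * (X1 i - tau thm / vm * V1 i)
   - (sg i ^ 2 - ss ^ 2) * (tau thm * V1 i)
   - gamma * sg i ^ 2 * (V i * X1 i)
   - (gamma - 1) * / 2 * sg i * (X1 i * X1 i)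
   + (gamma + 1) / 2 * ((sg i ^ 3 - ss ^ 3) * Q i)))).
{ intros i; assert (I0 := flux_identity i).
  set (L := sg i * v i * X2 i + (gamma - 1) * X3 i
    - X1 i * (sg i ^ 2 * vm - (gamma - 1) * pm)
    - gamma * sg i ^ 2 * V i * X1 i - (gamma - 1) * sg i * X1 i ^ 2 / 2) in I0.
  transitivity (Rg * vm / (pm * den) * (L + (gamma + 1) / 2 * ((sg i ^ 3 - ss ^ 3) * Q i)
    + (ss ^ 2 * mu thm + kappa thm / vm * ((gamma - 1) ^ 2 * pm / Rg)
       + tau thm / vm * (ss ^ 2 * vm - (gamma - 1) * pm)) * V1 i)).
  { unfold L; field; repeat split; lra. }
  rewrite I0; unfold A; fold den.
  replace (ss ^ 3) with (ss * (gamma * pm / vm)) by (rewrite <- S2; ring).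
  rewrite S2; apply Rminus_diag_uniq.
  transitivity (V1 i * ((Rg * tau thm + Rg * gamma * mu thm + (gamma - 1) ^ 2 * kappa thm) / den - 1));
    [field; repeat split; lra | fold den; field; lra]. }
assert (Hr : forall g, bigO small g eV ->
    bigO small g (fun i => Rabs (eps i * Q i) + Rabs (eps i * V1 i))).
{ intros g Hg; apply (bigO_trans _ _ _ Hg), bigO_sum_r. }
destruct X_V1 as [x1 _].
assert (S2' : bigO small (fun i => sg i ^ 2) (fun _ => 1)) by exact (O_1_of_minus _ _ sg_sq).
assert (S3 : bigO small (fun i => sg i ^ 2 * vm - (gamma - 1) * pm) (fun _ => 1)) by bigO.
apply bigO_scal; apply bigO_plus.
- apply Hr.
  assert (F1 := X1_frozen); assert (F2 := vX2_frozen); assert (F3 := X3_frozen).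
  assert (x1e := X1_eps); assert (s2 := sg_sq).
  repeat first [apply bigO_minus | apply bigO_plus].
  + apply bigO_mult_r; [bigO | assumption].
  + apply bigO_mult; [bigO | apply bigO_scal, bigO_refl].
  + now apply bigO_scal.
  + apply bigO_mult_r; [bigO | assumption].
  + apply bigO_mult; [exact s2 | apply bigO_scal, bigO_refl].
  + apply bigO_mult_r; [bigO | apply bigO_mult; [bigO | exact x1]].
  + apply bigO_mult_r; [bigO | now apply bigO_mult].
- apply bigO_scal; apply (bigO_trans _ (fun i => eps i * Q i)); [|apply bigO_sum_l].
  apply bigO_mult; [apply sg_cube | apply bigO_refl].
Qed.

(** Absorbs the eps * V1 in [V1_AQ_weak]; reinserting the result gives the sharp form [V1_AQ]. *)
Lemma V1_Q : bigO small V1 Q.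
Proof.
apply (bigO_absorb _ _ eps vanishing_eps).
apply (bigO_ext (fun i => (V1 i - A * Q i) + A * Q i)); [intros; ring|].
apply bigO_plus; [|apply bigO_scal, bigO_sum_l].
apply (bigO_trans _ _ _ V1_AQ_weak), bigO_plus; apply bigO_Rabs.
- apply bigO_mult_r; [apply eps_1 | apply bigO_sum_l].
- apply bigO_sum_r.
Qed.

Lemma V1_AQ : bigO small (fun i => V1 i - A * Q i) (fun i => eps i * Q i).
Proof.
apply (bigO_trans _ _ _ V1_AQ_weak), bigO_plus; apply bigO_Rabs; [apply bigO_refl|].
apply bigO_mult; [apply bigO_refl | apply V1_Q].
Qed.

Lemma bigO_eps_le f g d :
  bigO small f (fun i => eps i * g i) -> 0 < d ->
  small (fun i => Rabs (f i) <= d * Rabs (g i)).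
Proof.
intros (C & HC & H) Hd.
assert (H' : small (fun i => Rabs (eps i) <= d / (C + 1)))
  by (apply vanishing_eps, Rdiv_lt_0_compat; lra).
generalize (filter_and _ _ H H'); apply filter_imp; intros i [B D].
rewrite Rabs_mult in B; apply (Rle_trans _ _ _ B).
rewrite <- Rmult_assoc; apply Rmult_le_compat_r; [apply Rabs_pos|].
apply Rle_trans with ((C + 1) * (d / (C + 1))); [|apply Req_le; field; lra].
apply Rmult_le_compat; try lra; apply Rabs_pos.
Qed.

(** * Exponential decay and strict monotonicity *)

Definition W i := eps i - V i.

Lemma A_ss : 0 < A * ss.
Proof.
assert (S : 0 < ss ^ 2) by (apply pow2_gt_0, ss_neq0).
assert (DP := denominator_pos).
unfold A; set (den := Rg * tau thm + _ + _) in *.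
replace (Rg * gamma * ss / den * ((gamma + 1) / 2) * ss)
  with (Rg * gamma * ss ^ 2 * ((gamma + 1) / 2) / den) by (field; lra).
apply Rdiv_lt_0_compat; [|exact DP].
apply Rmult_lt_0_compat; [|lra]; apply Rmult_lt_0_compat; [|exact S].
apply Rmult_lt_0_compat; lra.
Qed.

Lemma eps_neq0 i : eps i <> 0.
Proof. intros E; assert (H := w_orient (fst i)); fold (eps i) in H; rewrite E in H; lra. Qed.

Lemma A_eps i : 0 < A * eps i.
Proof.
assert (H := w_orient (fst i)); fold (eps i) in H; assert (H' := A_ss).
assert (S : 0 < ss ^ 2) by (apply pow2_gt_0, ss_neq0).
apply Rmult_lt_reg_r with (ss ^ 2); [exact S|].
replace (A * eps i * ss ^ 2) with ((A * ss) * (ss * eps i)) by ring.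
rewrite Rmult_0_l; now apply Rmult_lt_0_compat.
Qed.

Lemma eps_V i : 0 <= eps i * V i <= eps i ^ 2.
Proof. rewrite Rmult_comm; apply w_V_range. Qed.

Lemma eps2_Q i : eps i ^ 2 * Q i = (eps i * V i) * (eps i ^ 2 - eps i * V i).
Proof. unfold Q; ring. Qed.

Lemma Q_nonneg i : 0 <= Q i.
Proof.
assert (H := eps_V i); assert (E := eps2_Q i).
assert (S : 0 < eps i ^ 2) by (apply pow2_gt_0, eps_neq0).
apply Rmult_le_reg_l with (eps i ^ 2); [exact S|].
rewrite E, Rmult_0_r; apply Rmult_le_pos; lra.
Qed.

Lemma abs_V i : Rabs (V i) * Rabs (eps i) = eps i * V i.
Proof. rewrite <- Rabs_mult, Rmult_comm; apply Rabs_pos_eq, eps_V. Qed.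

Lemma abs_W i : Rabs (W i) * Rabs (eps i) = eps i ^ 2 - eps i * V i.
Proof.
rewrite <- Rabs_mult; replace (W i * eps i) with (eps i ^ 2 - eps i * V i) by (unfold W; ring).
apply Rabs_pos_eq; generalize (eps_V i); lra.
Qed.

Lemma abs_V_le i : Rabs (V i) <= Rabs (eps i).
Proof.
assert (E := Rabs_pos_lt _ (eps_neq0 i)).
apply Rmult_le_reg_r with (Rabs (eps i)); [exact E|].
rewrite abs_V; generalize (eps_V i); rewrite <- pow2_abs; lra.
Qed.

Lemma abs_W_le i : Rabs (W i) <= Rabs (eps i).
Proof.
assert (E := Rabs_pos_lt _ (eps_neq0 i)).
apply Rmult_le_reg_r with (Rabs (eps i)); [exact E|].
rewrite abs_W; generalize (eps_V i); rewrite <- pow2_abs; lra.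
Qed.

Lemma abs_Q i : Rabs (Q i) = Rabs (V i) * Rabs (W i).
Proof. apply Rabs_mult. Qed.

(** Half of the logistic rate survives the error. Multiplication by eps makes the quantities
    positive in both shock families. *)
Lemma V1_lower : small (fun i => Rabs (A * eps i) / 2 * Q i <= eps i * V1 i).
Proof.
assert (HA : 0 < Rabs A / 2).
{ apply Rdiv_lt_0_compat; [|lra]; apply Rabs_pos_lt; generalize A_ss; intros H E.
  rewrite E in H; lra. }
generalize (bigO_eps_le _ _ _ V1_AQ HA); apply filter_imp; intros i H.
rewrite (Rabs_pos_eq (Q i)) in H by apply Q_nonneg.
assert (B := Rabs_mult (eps i) (V1 i - A * Q i)).
assert (B' := Rmult_le_compat_l _ _ _ (Rabs_pos (eps i)) H).
rewrite <- B in B'.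
replace (Rabs (eps i) * (Rabs A / 2 * Q i)) with (Rabs A * Rabs (eps i) / 2 * Q i) in B' by field.
rewrite <- Rabs_mult in B'.
assert (D := A_eps i); rewrite (Rabs_pos_eq (A * eps i)) in * by lra.
apply Rabs_le_between in B'; nra.
Qed.

(** A logistic inequality for f = eps * V on [0, eps ^ 2]. The rate |A| / 4 is |A| halved twice:
    once in [V1_lower], and once because only the factor of f * (eps ^ 2 - f) that stays at least
    eps ^ 2 / 2 on the given half-line is bounded below. *)
Lemma decay :
  small (fun i =>
    (snd i <= 0 -> Rabs (V i) <= Rabs (eps i) * exp (- (Rabs A / 4) * Rabs (eps i) * Rabs (snd i))) /\
    (0 <= snd i -> Rabs (W i) <= Rabs (eps i) * exp (- (Rabs A / 4) * Rabs (eps i) * Rabs (snd i)))).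
Proof.
destruct V1_lower as (e0 & He0 & H); exists e0; split; [exact He0|].
intros w x Hw; assert (HL := fun y => H w y Hw); clear H; simpl snd.
set (e := wVp w) in *.
pose (f := fun y => e * V (w, y)).
assert (fd : forall y, is_derive f y (e * V1 (w, y))) by (intros y; apply is_derive_scal, w_dV).
assert (fr : forall y, 0 <= f y <= e ^ 2) by (intros y; apply (eps_V (w, y))).
assert (ep : e <> 0) by apply (eps_neq0 (w, x)).
assert (e2 : 0 < e ^ 2) by now apply pow2_gt_0.
assert (Ap := A_eps (w, x)); unfold eps in Ap; simpl fst in Ap; fold e in Ap.
(* The midpoint normalization enters here: with [fm] it tells on which side of e ^ 2 / 2 the
   function f lies. *)
assert (f0 : f 0 = e ^ 2 / 2) by (unfold f, V, e; simpl; rewrite w_V_0; field).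
set (l := Rabs A / 4 * Rabs e).
assert (lE : Rabs (A * e) = 4 * l) by (rewrite Rabs_mult; unfold l; field).
assert (lp : 0 < l) by (rewrite Rabs_pos_eq in lE by lra; lra).
assert (fl : forall y, 2 * l * (f y * (e ^ 2 - f y)) <= e ^ 2 * (e * V1 (w, y))).
{ intros y; specialize (HL y).
  change (eps (w, y)) with e in HL; rewrite lE in HL.
  assert (E := eps2_Q (w, y)); change (eps (w, y)) with e in E; fold (f y) in E.
  rewrite <- E.
  replace (2 * l * (e ^ 2 * Q (w, y))) with (e ^ 2 * (4 * l / 2 * Q (w, y))) by field.
  apply Rmult_le_compat_l; lra. }
assert (fm : forall a b, a <= b -> f a <= f b).
{ intros a b Hab; assert (Gr := gronwall f (fun y => e * V1 (w, y)) 0 a b Hab (fun y _ => fd y)).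
  rewrite Rmult_0_l, exp_0, Rmult_1_r in Gr; apply Gr; intros y _; rewrite Rmult_0_l.
  apply Rmult_le_reg_l with (e ^ 2); [exact e2|]; rewrite Rmult_0_r.
  refine (Rle_trans _ _ _ _ (fl y)); specialize (fr y).
  apply Rmult_le_pos; [lra|]; apply Rmult_le_pos; lra. }
assert (Ep := Rabs_pos_lt _ ep).
assert (E2 : Rabs e * Rabs e = e ^ 2) by (rewrite <- (pow2_abs e); ring).
split; intros Hx; apply Rmult_le_reg_r with (Rabs e); try exact Ep;
  change (Rabs (eps (w, x))) with (Rabs e).
- assert (AV := abs_V (w, x)); change (eps (w, x)) with e in AV; rewrite AV; fold (f x).
  replace (- (Rabs A / 4) * Rabs e * Rabs x) with (- (l * (0 - x)))
    by (unfold l; rewrite (Rabs_left1 x Hx); ring).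
  assert (Gr := gronwall f (fun y => e * V1 (w, y)) l x 0 Hx (fun y _ => fd y)).
  rewrite f0 in Gr; rewrite exp_Ropp.
  assert (X := exp_pos (l * (0 - x))).
  apply Rmult_le_reg_r with (exp (l * (0 - x))); [exact X|].
  replace (Rabs e * / exp (l * (0 - x)) * Rabs e * exp (l * (0 - x))) with (Rabs e * Rabs e)
    by (field; lra).
  rewrite E2; apply Rle_trans with (e ^ 2 / 2); [|lra].
  apply Gr; intros y [_ Hy].
  assert (B := fm _ _ Hy); rewrite f0 in B.
  apply Rmult_le_reg_l with (e ^ 2); [exact e2|].
  refine (Rle_trans _ _ _ _ (fl y)); specialize (fr y).
  assert (0 <= (e ^ 2 - 2 * f y) * (l * f y)) by (apply Rmult_le_pos; [|apply Rmult_le_pos]; lra).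
  lra.
- assert (AW := abs_W (w, x)); change (eps (w, x)) with e in AW; rewrite AW; fold (f x).
  replace (- (Rabs A / 4) * Rabs e * Rabs x) with (- l * (x - 0))
    by (unfold l; rewrite (Rabs_pos_eq x Hx); ring).
  assert (Gr := gronwall (fun y => f y - e ^ 2) (fun y => e * V1 (w, y)) (- l) 0 x Hx).
  cbv beta in Gr; rewrite f0 in Gr.
  assert (X := exp_pos (- l * (x - 0))).
  assert (Z : (e ^ 2 / 2 - e ^ 2) * exp (- l * (x - 0)) <= f x - e ^ 2).
  { apply Gr.
    - intros y _.
      evar_last; [apply (is_derive_minus f (fun _ => e ^ 2)); [apply fd | apply is_derive_const]|].
      unfold minus, plus, opp, zero; simpl; ring.
    - intros y [Hy _].
      assert (B := fm _ _ Hy); rewrite f0 in B.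
      apply Rmult_le_reg_l with (e ^ 2); [exact e2|].
      refine (Rle_trans _ _ _ _ (fl y)); specialize (fr y).
      assert (0 <= (2 * f y - e ^ 2) * (l * (e ^ 2 - f y)))
        by (apply Rmult_le_pos; [|apply Rmult_le_pos]; lra).
      lra. }
  replace (Rabs e * exp (- l * (x - 0)) * Rabs e) with (e ^ 2 * exp (- l * (x - 0)))
    by (rewrite <- E2; ring).
  assert (0 < e ^ 2 * exp (- l * (x - 0))) by (now apply Rmult_lt_0_compat).
  lra.
Qed.

(** A zero of V1 is a zero of Q by [V1_lower]. As V1 = O(Q), the derivative of Q ^ 2 is bounded by a
    multiple of Q ^ 2, so Q and then V1 would vanish everywhere, against [w_nonconst]. *)
Lemma V1_nonzero : small (fun i => V1 i <> 0).
Proof.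
destruct V1_Q as (C & HC & H1).
destruct (filter_and _ _ H1 V1_lower) as (e0 & He0 & H); exists e0; split; [exact He0|].
intros w x Hw Hx; apply (w_nonconst w); intros y.
assert (HQ : forall z, Q (w, z) ^ 2 = 0).
{ apply (zero_propagates (fun z => Q (w, z) ^ 2)
    (fun z => 2 * Q (w, z) * ((wVp w - 2 * wV w z) * wV1 w z)) (2 * Rabs (wVp w) * C) x).
  - intros z; assert (D := w_dV w z).
    change (is_derive (fun z => (wV w z * (wVp w - wV w z)) ^ 2) z
      (2 * (wV w z * (wVp w - wV w z)) * ((wVp w - 2 * wV w z) * wV1 w z))).
    auto_derive; [repeat split; eexists; exact D|].
    rewrite_derivatives; ring.
  - intros z; apply pow2_ge_0.
  - intros z; destruct (H w z Hw) as [B _]; unfold V1 in B; simpl in B.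
    rewrite !Rabs_mult, (Rabs_pos_eq 2) by lra.
    rewrite <- (pow2_abs (Q (w, z))).
    (* Because (eps - 2 * V) ^ 2 = eps ^ 2 - 4 * Q. *)
    assert (Bv : Rabs (wVp w - 2 * wV w z) <= Rabs (wVp w)).
    { apply Rsqr_le_abs_0; unfold Rsqr.
      assert (Qp := Q_nonneg (w, z)); unfold Q, V, eps in Qp; simpl in Qp; lra. }
    replace (2 * Rabs (wVp w) * C * Rabs (Q (w, z)) ^ 2) with
      (2 * Rabs (Q (w, z)) * (Rabs (wVp w) * (C * Rabs (Q (w, z))))) by ring.
    apply Rmult_le_compat_l; [generalize (Rabs_pos (Q (w, z))); lra|].
    apply Rmult_le_compat; auto using Rabs_pos.
  - destruct (H w x Hw) as [_ B]; rewrite Hx, Rmult_0_r in B.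
    assert (Qp := Q_nonneg (w, x)).
    assert (0 < Rabs (A * eps (w, x)) / 2).
    { apply Rdiv_lt_0_compat; [|lra]; apply Rabs_pos_lt; generalize (A_eps (w, x)); lra. }
    assert (Q (w, x) = 0) by nra. rewrite H2; ring. }
destruct (H w y Hw) as [B _]; specialize (HQ y).
assert (Q0 : Q (w, y) = 0) by nra.
rewrite Q0, Rabs_R0, Rmult_0_r in B.
destruct (Req_dec (V1 (w, y)) 0) as [|Nz]; [assumption|].
generalize (Rabs_pos_lt _ Nz); lra.
Qed.

(** * Comparison of all components with V near the left end and W near the right end *)

Lemma W_1 : bigO small W (fun _ => 1).
Proof. unfold W; bigO. Qed.

Lemma Q_V : bigO small Q V.
Proof. apply bigO_mult_l; [apply bigO_refl | apply W_1]. Qed.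

Lemma Q_W : bigO small Q W.
Proof. apply bigO_mult_r; [bigO | apply bigO_refl]. Qed.

Lemma X_Q : bigO small X1 Q /\ bigO small X3 Q.
Proof. destruct X_V1 as (A1 & _ & A3); split; eapply bigO_trans; eauto using V1_Q. Qed.

Lemma inv_sg_1 : bigO small (fun i => / sg i) (fun _ => 1).
Proof. exact (bigO_inv _ _ _ ss_neq0 vanishing_eps sg_ss). Qed.

Lemma sg_neq0 i : sg i <> 0.
Proof. assert (H := w_sign (fst i)); fold (sg i) in H; intros E; rewrite E in H; lra. Qed.

(** The integrated equation gives U algebraically from V and X1, and X1 = O(Q) = O(V); so U inherits
    the decay of V, and [T_V] follows in the same way from X3. *)
Lemma U_V : bigO small U V.
Proof.
apply (bigO_ext (fun i => - sg i * V i - X1 i)); [intros; rewrite X1E; ring|].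
apply bigO_minus; [bigO | exact (bigO_trans _ _ _ (proj1 X_Q) Q_V)].
Qed.

Lemma T_V : bigO small T V.
Proof.
assert (uv := U_V); assert (is := inv_sg_1).
assert (x3 := bigO_trans _ _ _ (proj2 X_Q) Q_V).
apply (bigO_ext (fun i => (gamma - 1) / Rg * / sg i *
   (/ 2 * sg i * U i * U i + pm * U i - X3 i))).
- intros i; assert (N := sg_neq0 i); rewrite X3E; field; lra.
- apply bigO_mult_r; bigO.
Qed.

(** [Up] and [Tp] are the jumps of u and theta, expressed by Rankine-Hugoniot through the strength
    and the speed. *)
Definition Up i := - sg i * eps i.
Definition Tp i := (gamma - 1) / Rg * (sg i ^ 2 * eps i ^ 2 / 2 - pm * eps i).

Lemma U_W : bigO small (fun i => U i - Up i) W.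
Proof.
apply (bigO_ext (fun i => sg i * W i - X1 i)); [intros; rewrite X1E; unfold W, Up; ring|].
apply bigO_minus; [bigO | exact (bigO_trans _ _ _ (proj1 X_Q) Q_W)].
Qed.

Lemma T_W : bigO small (fun i => T i - Tp i) W.
Proof.
assert (uw := U_W); assert (is := inv_sg_1).
assert (x3 := bigO_trans _ _ _ (proj2 X_Q) Q_W).
(* The right-hand side of the energy flux vanishes at (Up, Tp); subtracting it leaves factors U -
   Up. *)
apply (bigO_ext (fun i => (gamma - 1) / Rg * / sg i *
   (/ 2 * sg i * ((U i + Up i) * (U i - Up i)) + pm * (U i - Up i) - X3 i))).
- intros i; assert (N := sg_neq0 i); rewrite X3E; unfold Tp, Up; field; lra.
- assert (u1 : bigO small (fun i => U i + Up i) (fun _ => 1)) by (unfold Up; bigO).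
  apply bigO_mult_r; bigO.
Qed.

Lemma W_minus : bigO small (fun i => V i - eps i) W.
Proof. apply (bigO_ext (fun i => - W i)); [intros; unfold W; ring | bigO]. Qed.

Lemma V1_U1 : bigO small V1 U1.
Proof.
assert (N := ss_neq0).
apply (bigO_absorb _ _ eps vanishing_eps).
apply (bigO_ext (fun i => / ss * ((U1 i + ss * V1 i) - U1 i))); [intros; field; exact N|].
apply bigO_scal, bigO_minus.
- exact (bigO_trans _ _ _ U1_slaved (bigO_sum_r _ _)).
- apply bigO_sum_l.
Qed.

Lemma V1_T1 : bigO small V1 T1.
Proof.
assert (P := pm_pos).
apply (bigO_absorb _ _ eps vanishing_eps).
apply (bigO_ext (fun i => Rg / ((gamma - 1) * pm) *
  ((T1 i + (gamma - 1) * pm / Rg * V1 i) - T1 i))); [intros; field; lra|].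
apply bigO_scal, bigO_minus.
- exact (bigO_trans _ _ _ T1_slaved (bigO_sum_r _ _)).
- apply bigO_sum_l.
Qed.

Definition estimates (C : R) i : Prop :=
  ((snd i <= 0 -> norm3 (V i) (U i) (T i)
      <= C * Rabs (eps i) * exp (- (Rabs A / 4) * Rabs (eps i) * Rabs (snd i))) /\
   (0 <= snd i -> norm3 (V i - eps i) (U i - Up i) (T i - Tp i)
      <= C * Rabs (eps i) * exp (- (Rabs A / 4) * Rabs (eps i) * Rabs (snd i)))) /\
  norm3 (V1 i) (U1 i) (T1 i)
    <= C * Rabs (eps i) ^ 2 * exp (- (Rabs A / 4) * Rabs (eps i) * Rabs (snd i)) /\
  norm3 (V2 i) (U2 i) (T2 i) <= C * Rabs (eps i) * norm3 (V1 i) (U1 i) (T1 i) /\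
  (/ C * Rabs (V1 i) <= Rabs (U1 i) <= C * Rabs (V1 i) /\
   / C * Rabs (V1 i) <= Rabs (T1 i) <= C * Rabs (V1 i) /\
   Rabs (U1 i + ss * V1 i) <= C * Rabs (eps i) * Rabs (V1 i) /\
   Rabs (T1 i + (gamma - 1) * pm / Rg * V1 i) <= C * Rabs (eps i) * Rabs (V1 i)) /\
  Rabs (sg i - ss) <= C * Rabs (eps i) /\
  (0 < ss * V1 i /\ U1 i < 0 /\ ss * T1 i < 0) /\
  Rabs (V1 i - A * Q i) <= C * Rabs (eps i) * Q i.

(** Asking for every C beyond a threshold makes the notion stable under conjunction, so that one
    constant serves all the estimates. *)
Definition eventually_large (P : R -> J -> Prop) : Prop :=
  exists C0, 0 < C0 /\ small (fun i => forall C, C0 <= C -> P C i).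

Lemma eventually_large_and P P' :
  eventually_large P -> eventually_large P' -> eventually_large (fun C i => P C i /\ P' C i).
Proof.
intros (C & HC & H) (D & HD & H'); exists (C + D); split; [lra|].
generalize (filter_and _ _ H H'); apply filter_imp; intros i [X Y] E HE.
split; [apply X | apply Y]; lra.
Qed.

Lemma eventually_large_of_small (P : J -> Prop) :
  small P -> eventually_large (fun _ => P).
Proof. intros H; exists 1; split; [lra|]; revert H; apply filter_imp; auto. Qed.

Lemma eventually_large_bigO f g :
  bigO small f g -> eventually_large (fun C i => Rabs (f i) <= C * Rabs (g i)).
Proof.
intros (C & HC & H); exists (C + 1); split; [lra|].
revert H; apply filter_imp; intros i H E HE.
apply (Rle_trans _ _ _ H), Rmult_le_compat_r; [apply Rabs_pos | lra].
Qed.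

Lemma eventually_large_imp (P P' : R -> J -> Prop) :
  (forall C i, 0 < C -> P C i -> P' C i) -> eventually_large P -> eventually_large P'.
Proof.
intros I0 (C & HC & H); exists C; split; [exact HC|].
revert H; apply filter_imp; intros i H E HE; apply I0; [lra | auto].
Qed.

(** V1 has the sign of eps by [V1_lower] and [V1_nonzero], hence that of ss. The slaving errors are
    taken below half of the main terms, so U1 and T1 get the signs of - ss * V1 and - V1. *)
Lemma sign_pattern : small (fun i => 0 < ss * V1 i /\ U1 i < 0 /\ ss * T1 i < 0).
Proof.
assert (P := pm_pos); assert (N := ss_neq0).
assert (S : 0 < ss ^ 2) by now apply pow2_gt_0.
assert (HA := A_ss).
assert (K : 0 < (gamma - 1) * pm / Rg).
{ apply Rdiv_lt_0_compat; [apply Rmult_lt_0_compat|]; lra. }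
assert (H1 := bigO_eps_le _ _ (Rabs ss / 2) U1_slaved
  ltac:(generalize (Rabs_pos_lt _ N); lra)).
assert (H2 := bigO_eps_le _ _ ((gamma - 1) * pm / Rg / 2) T1_slaved ltac:(lra)).
generalize (filter_and _ _ (filter_and _ _ H1 H2) (filter_and _ _ V1_lower V1_nonzero)).
apply filter_imp; intros i [[B1 B2] [B3 B4]].
assert (E := w_orient (fst i)); fold (eps i) in E.
assert (ev : 0 < eps i * V1 i).
{ assert (0 <= eps i * V1 i).
  { refine (Rle_trans _ _ _ _ B3); apply Rmult_le_pos; [|apply Q_nonneg].
    generalize (Rabs_pos (A * eps i)); lra. }
  assert (eps i * V1 i <> 0)
    by (apply Rmult_integral_contrapositive; split; [apply eps_neq0 | exact B4]).
  lra. }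
assert (sv : 0 < ss * V1 i).
{ assert (e2 : 0 < eps i ^ 2) by (apply pow2_gt_0, eps_neq0).
  apply Rmult_lt_reg_r with (eps i ^ 2); [exact e2|]; rewrite Rmult_0_l.
  replace (ss * V1 i * eps i ^ 2) with ((ss * eps i) * (eps i * V1 i)) by ring.
  now apply Rmult_lt_0_compat. }
assert (av : Rabs ss * Rabs (V1 i) = ss * V1 i)
  by (rewrite <- Rabs_mult; apply Rabs_pos_eq; lra).
split; [exact sv|]; split.
+ apply Rabs_le_between in B1; lra.
+ set (k := (gamma - 1) * pm / Rg) in *.
  assert (B2' := Rmult_le_compat_l _ _ _ (Rabs_pos ss) B2).
  rewrite <- Rabs_mult in B2'.
  replace (Rabs ss * (k / 2 * Rabs (V1 i))) with (k / 2 * (Rabs ss * Rabs (V1 i))) in B2' by ring.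
  rewrite av in B2'; apply Rabs_le_between in B2'.
  assert (0 < k * (ss * V1 i)) by (now apply Rmult_lt_0_compat).
  lra.
Qed.

Lemma estimates_hold : eventually_large estimates.
Proof.
assert (NP : forall a b c, Rabs (norm3 a b c) = norm3 a b c)
  by (intros; apply Rabs_pos_eq, sqrt_pos).
assert (dec := eventually_large_of_small _ decay).
assert (signs := eventually_large_of_small _ sign_pattern).
repeat apply eventually_large_and.
- assert (H : bigO small (fun i => norm3 (V i) (U i) (T i)) V)
    by (apply bigO_norm3; [apply bigO_refl | apply U_V | apply T_V]).
  generalize (eventually_large_and _ _ (eventually_large_bigO _ _ H) dec).
  apply eventually_large_imp; intros C i HC [B [D _]] Hx; rewrite NP in B.
  apply (Rle_trans _ _ _ B); rewrite Rmult_assoc.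
  apply Rmult_le_compat_l; [lra | now apply D].
- assert (H : bigO small (fun i => norm3 (V i - eps i) (U i - Up i) (T i - Tp i)) W)
    by (apply bigO_norm3; [apply W_minus | apply U_W | apply T_W]).
  generalize (eventually_large_and _ _ (eventually_large_bigO _ _ H) dec).
  apply eventually_large_imp; intros C i HC [B [_ D]] Hx; rewrite NP in B.
  apply (Rle_trans _ _ _ B); rewrite Rmult_assoc.
  apply Rmult_le_compat_l; [lra | now apply D].
- assert (H : bigO small (fun i => norm3 (V1 i) (U1 i) (T1 i)) Q).
  { apply (fun H => bigO_trans _ _ _ H V1_Q).
    apply bigO_norm3; [apply bigO_refl | apply U1_V1 | apply T1_V1]. }
  generalize (eventually_large_and _ _ (eventually_large_bigO _ _ H) dec).
  apply eventually_large_imp; intros C i HC [B [D D']]; rewrite NP in B.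
  apply (Rle_trans _ _ _ B); rewrite Rmult_assoc.
  apply Rmult_le_compat_l; [lra|]; rewrite abs_Q.
  assert (v0 := abs_V_le i); assert (w0 := abs_W_le i).
  assert (v' := Rabs_pos (V i)); assert (w' := Rabs_pos (W i)).
  destruct (Rle_or_lt (snd i) 0) as [Hx|Hx].
  + replace (Rabs (eps i) ^ 2 * exp (- (Rabs A / 4) * Rabs (eps i) * Rabs (snd i))) with
     (Rabs (eps i) * exp (- (Rabs A / 4) * Rabs (eps i) * Rabs (snd i)) * Rabs (eps i)) by ring.
    apply Rmult_le_compat; auto.
  + replace (Rabs (eps i) ^ 2 * exp (- (Rabs A / 4) * Rabs (eps i) * Rabs (snd i))) with
     (Rabs (eps i) * (Rabs (eps i) * exp (- (Rabs A / 4) * Rabs (eps i) * Rabs (snd i)))) by ring.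
    apply Rmult_le_compat; auto; apply D'; lra.
- assert (H : bigO small (fun i => norm3 (V2 i) (U2 i) (T2 i)) eV)
    by (apply bigO_norm3; [apply V2_eV | apply U2_eV | apply T2_eV]).
  generalize (eventually_large_bigO _ _ H).
  apply eventually_large_imp; intros C i HC B; rewrite NP in B.
  apply (Rle_trans _ _ _ B); unfold eV; rewrite Rabs_mult, Rmult_assoc.
  apply Rmult_le_compat_l; [lra|].
  apply Rmult_le_compat_l; [apply Rabs_pos | apply norm3_ge].
- generalize (eventually_large_bigO _ _ V1_U1).
  apply eventually_large_imp; intros C i HC B.
  apply Rmult_le_reg_l with C; [exact HC|]; rewrite <- Rmult_assoc, Rinv_r, Rmult_1_l; lra.
- apply (eventually_large_bigO _ _ U1_V1).
- generalize (eventually_large_bigO _ _ V1_T1).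
  apply eventually_large_imp; intros C i HC B.
  apply Rmult_le_reg_l with C; [exact HC|]; rewrite <- Rmult_assoc, Rinv_r, Rmult_1_l; lra.
- apply (eventually_large_bigO _ _ T1_V1).
- generalize (eventually_large_bigO _ _ U1_slaved).
  apply eventually_large_imp; intros C i HC; unfold eV; rewrite Rabs_mult; lra.
- generalize (eventually_large_bigO _ _ T1_slaved).
  apply eventually_large_imp; intros C i HC; unfold eV; rewrite Rabs_mult; lra.
- apply (eventually_large_bigO _ _ sg_ss).
- exact (eventually_large_imp _ _ (fun _ _ _ H => proj1 H) signs).
- exact (eventually_large_imp _ _ (fun _ _ _ H => proj1 (proj2 H)) signs).
- exact (eventually_large_imp _ _ (fun _ _ _ H => proj2 (proj2 H)) signs).
- generalize (eventually_large_bigO _ _ V1_AQ).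
  apply eventually_large_imp; intros C i HC; rewrite Rabs_mult, (Rabs_pos_eq (Q i)) by apply Q_nonneg.
  lra.
Qed.

End Waves.

Arguments wVp {Rg gamma tau mu kappa vm thm pm ss} _.
Arguments wsg {Rg gamma tau mu kappa vm thm pm ss} _.
Arguments wV {Rg gamma tau mu kappa vm thm pm ss} _.
Arguments wU {Rg gamma tau mu kappa vm thm pm ss} _.
Arguments wT {Rg gamma tau mu kappa vm thm pm ss} _.
Arguments wV1 {Rg gamma tau mu kappa vm thm pm ss} _.
Arguments wU1 {Rg gamma tau mu kappa vm thm pm ss} _.
Arguments wT1 {Rg gamma tau mu kappa vm thm pm ss} _.
Arguments wV2 {Rg gamma tau mu kappa vm thm pm ss} _.
Arguments wU2 {Rg gamma tau mu kappa vm thm pm ss} _.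
Arguments wT2 {Rg gamma tau mu kappa vm thm pm ss} _.

(** * From profiles to integrated profiles *)

Lemma constant_of_derive_zero (f : R -> R) :
  (forall x, is_derive f x 0) -> forall x y, f x = f y.
Proof.
intros H x y; destruct (Rtotal_order x y) as [L|[->|L]]; [| reflexivity |].
- apply (eq_is_derive f x y); [intros; apply H | exact L].
- symmetry; apply (eq_is_derive f y x); [intros; apply H | exact L].
Qed.

Lemma monotone_between (f : R -> R) (a b : R) :
  monotone f -> is_lim f m_infty a -> is_lim f p_infty b ->
  forall x, a <= f x <= b \/ b <= f x <= a.
Proof.
intros [H|H] Ha Hb x; [left | right]; split.
- apply (is_lim_le_loc f (fun _ => f x) m_infty a (f x)); [|exact Ha | apply is_lim_const].
  exists x; intros y Hy; apply H; lra.
- apply (is_lim_le_loc (fun _ => f x) f p_infty (f x) b); [| apply is_lim_const | exact Hb].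
  exists x; intros y Hy; apply H; lra.
- apply (is_lim_le_loc f (fun _ => f x) p_infty b (f x)); [|exact Hb | apply is_lim_const].
  exists x; intros y Hy; apply H; lra.
- apply (is_lim_le_loc (fun _ => f x) f m_infty (f x) a); [| apply is_lim_const | exact Ha].
  exists x; intros y Hy; apply H; lra.
Qed.

(** If the flux converges at -oo, so does the derivative Y1, and the convergence of Y forces its
    limit to be 0. This fixes the integration constants without assuming that derivatives decay. *)
Lemma flux_limit (f v th Y Y1 : R -> R) (vm thm l L : R) :
  positive_C2 f -> 0 < vm -> 0 < thm ->
  (forall x, 0 < v x) -> (forall x, 0 < th x) ->
  is_lim v m_infty vm -> is_lim th m_infty thm -> is_lim Y m_infty l ->
  (forall x, is_derive Y x (Y1 x)) ->
  is_lim (fun x => f (th x) * (Y1 x / v x)) m_infty L -> L = 0.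
Proof.
intros Hf Hvm Hthm Hv Hth Lv Lth LY DY LF.
assert (fp : 0 < f thm) by now apply Hf.
assert (Lf : is_lim (fun x => f (th x)) m_infty (f thm)).
{ apply is_lim_comp_continuous; [exact Lth|].
  apply (ex_derive_continuous f); eexists.
  exact (proj1 (C2_derivatives f _ _ (proj2 Hf) Hthm)). }
assert (Z : vm * / f thm * L = 0).
{ apply (lim_derive_zero Y Y1 l); [exact DY | exact LY|].
  apply (is_lim_ext (fun x => v x * / f (th x) * (f (th x) * (Y1 x / v x)))).
  - intros x; assert (A := Hv x); assert (B := proj1 Hf _ (Hth x)); field; lra.
  - apply (is_lim_mult _ _ _ (vm * / f thm) L); [|exact LF | exact I].
    apply (is_lim_mult _ _ _ vm (/ f thm)); [exact Lv | | exact I].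
    apply (is_lim_inv _ _ (f thm)); [exact Lf|].
    intros E; injection E; lra. }
assert (0 < vm * / f thm) by (apply Rmult_lt_0_compat; [|apply Rinv_0_lt_compat]; lra).
nra.
Qed.

Lemma is_derive_flux (f v th Y : R -> R) x :
  positive_C2 f -> 0 < v x -> 0 < th x ->
  ex_derive v x -> ex_derive th x -> ex_derive Y x ->
  ex_derive (fun x => f (th x) * (Y x / v x)) x.
Proof.
intros Hf Hv Hth Dv Dth DY.
assert (Df : ex_derive f (th x))
  by (eexists; exact (proj1 (C2_derivatives f _ _ (proj2 Hf) Hth))).
auto_derive; repeat split; try assumption; lra.
Qed.

(** The sign of the speed in the hypothesis is forced by up < um, which identifies it with
    [shock_speed]. The last identity relates speed and strength: it is the gas law at the right
    state, with one factor vp - vm divided out. *)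
Lemma Rankine_Hugoniot_facts (Rg gamma vm um thm vp up thp : R) :
  0 < Rg -> 1 < gamma -> 0 < vm -> 0 < thm -> 0 < vp ->
  Rankine_Hugoniot Rg gamma vm um thm vp up thp ->
  Lax vm um thm vp up thp ->
  let pm := pressure Rg vm thm in
  let sigma := shock_speed Rg vm thm vp thp in
  0 < sigma * (vp - vm) /\
  up - um = - sigma * (vp - vm) /\
  pressure Rg vp thp - pm = sigma * (up - um) /\
  thp - thm = (gamma - 1) / Rg * (sigma ^ 2 * (vp - vm) ^ 2 / 2 - pm * (vp - vm)) /\
  sigma ^ 2 * (vm + (gamma + 1) / 2 * (vp - vm)) = gamma * pm.
Proof.
intros hRg hg hvm hthm hvp (s & E1 & E2 & E3) HL pm sigma.
assert (Vn : vp - vm <> 0) by (destruct HL as [HL|HL]; lra).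
assert (sp : 0 < s * (vp - vm)) by (destruct HL as [HL|HL]; lra).
assert (sn : s <> 0) by (intros E; rewrite E in sp; lra).
assert (Es : sigma = s).
{ unfold sigma, shock_speed.
  replace (- ((pressure Rg vp thp - pressure Rg vm thm) / (vp - vm))) with (s ^ 2).
  - rewrite <- (pow2_abs s), sqrt_pow2 by apply Rabs_pos.
    destruct Rlt_dec.
    + rewrite Rabs_left; [ring | nra].
    + rewrite Rabs_pos_eq; [reflexivity | nra].
  - replace (pressure Rg vp thp - pressure Rg vm thm) with (- s ^ 2 * (vp - vm)); [field; lra|].
    replace (up - um) with (- s * (vp - vm)) in E2 by lra; lra. }
rewrite Es; clear Es sigma.
assert (HU : up - um = - s * (vp - vm)) by lra.
assert (HP : pressure Rg vp thp = pm + s * (up - um)) by (unfold pm; lra).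
assert (HT : thp - thm = (gamma - 1) / Rg * (s ^ 2 * (vp - vm) ^ 2 / 2 - pm * (vp - vm))).
{ fold pm in E3; rewrite HP in E3; unfold energy in E3.
  replace up with (um - s * (vp - vm)) in E3 by lra.
  apply Rmult_eq_reg_l with (s * (Rg / (gamma - 1))).
  2:{ apply Rmult_integral_contrapositive; split; [exact sn|].
      apply Rgt_not_eq, Rdiv_lt_0_compat; lra. }
  transitivity (s * (s ^ 2 * (vp - vm) ^ 2 / 2 - pm * (vp - vm))); [|field; lra].
  apply Rminus_diag_uniq; rewrite <- Ropp_0, <- E3; field; lra. }
repeat split; try assumption; [lra|].
assert (pv : pm * vm = Rg * thm) by (unfold pm, pressure; field; lra).
assert (pv' : (pm - s ^ 2 * (vp - vm)) * vp = Rg * thp).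
{ replace (pm - s ^ 2 * (vp - vm)) with (pressure Rg vp thp) by (rewrite HP, HU; ring).
  unfold pressure; field; lra. }
apply Rmult_eq_reg_l with (vp - vm); [|exact Vn].
replace (Rg * thp) with (pm * vm + Rg * (thp - thm)) in pv' by (rewrite pv; ring).
rewrite HT in pv'.
replace (Rg * ((gamma - 1) / Rg * (s ^ 2 * (vp - vm) ^ 2 / 2 - pm * (vp - vm)))) with
  ((gamma - 1) * (s ^ 2 * (vp - vm) ^ 2 / 2 - pm * (vp - vm))) in pv' by (field; lra).
lra.
Qed.

(** * Integration of the profile equations from -oo *)

Section Profile.
Variables (Rg gamma : R) (tau mu kappa : R -> R) (vm um thm vp up thp : R).
Hypotheses (hRg : 0 < Rg) (hgamma : 1 < gamma).
Hypotheses (htau : positive_C2 tau) (hmu : positive_C2 mu) (hkappa : positive_C2 kappa).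
Hypotheses (hvm : 0 < vm) (hthm : 0 < thm).
Variables (sigma : R) (v u th : R -> R).
Hypotheses (v_gt0 : forall x, 0 < v x) (th_gt0 : forall x, 0 < th x).
Hypotheses (v_C2 : C2_on (fun _ => True) v) (u_C2 : C2_on (fun _ => True) u)
  (th_C2 : C2_on (fun _ => True) th).
Hypothesis system : profile_system Rg gamma tau mu kappa sigma v u th.
Hypotheses (v_lim : is_lim v m_infty vm) (u_lim : is_lim u m_infty um)
  (th_lim : is_lim th m_infty thm).

Let pm := pressure Rg vm thm.

Let dv x : is_derive v x (Derive v x) := proj1 (C2_derivatives _ _ x v_C2 I).
Let du x : is_derive u x (Derive u x) := proj1 (C2_derivatives _ _ x u_C2 I).
Let dth x : is_derive th x (Derive th x) := proj1 (C2_derivatives _ _ x th_C2 I).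

Lemma mass_flux x : tau (th x) * (Derive v x / v x) = - sigma * (v x - vm) - (u x - um).
Proof.
pose (F := fun x => tau (th x) * (Derive v x / v x)).
pose (H := fun x => F x - (- sigma * v x - u x)).
assert (D : forall y, is_derive H y 0).
{ intros y; assert (E := proj1 (system y)).
  assert (dF : ex_derive F y).
  { apply is_derive_flux; auto; try (eexists; auto; fail).
    eexists; exact (proj2 (C2_derivatives _ _ y v_C2 I)). }
  apply Derive_correct in dF; change (fun x => tau (th x) * (Derive v x / v x)) with F in E.
  evar_last; [apply (is_derive_minus F (fun x => - sigma * v x - u x)); [exact dF|]|].
  - apply (is_derive_minus (fun x => - sigma * v x) u); [apply is_derive_scal, dv | apply du].
  - unfold minus, plus, opp; simpl; rewrite <- E; ring. }
assert (C := constant_of_derive_zero H D).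
assert (L : is_lim F m_infty (H 0 + (- sigma * vm - um))).
{ apply (is_lim_ext (fun x => H 0 + (- sigma * v x - u x))).
  - intros y; rewrite (C 0 y); unfold H; ring.
  - apply (is_lim_plus' _ _ _ (H 0) (- sigma * vm - um)); [apply is_lim_const|].
    apply (is_lim_minus' _ _ _ (- sigma * vm) um); [|exact u_lim].
    apply (is_lim_scal_l v (- sigma) m_infty vm v_lim). }
apply (flux_limit tau v th v (Derive v) vm thm vm) in L; auto.
assert (E := C x 0); unfold H at 1 in E; unfold F in E; lra.
Qed.

Lemma pressure_lim : is_lim (fun x => pressure Rg (v x) (th x)) m_infty pm.
Proof.
unfold pressure, pm.
apply (is_lim_div (fun x => Rg * th x) v m_infty (Rg * thm) vm).
- apply (is_lim_scal_l th Rg m_infty thm th_lim).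
- exact v_lim.
- intros E; injection E; lra.
- exact I.
Qed.

Lemma ex_derive_pressure x : ex_derive (fun x => pressure Rg (v x) (th x)) x.
Proof.
assert (A := dv x); assert (B := dth x); assert (P := v_gt0 x).
unfold pressure; auto_derive; repeat split; try (eexists; eassumption); lra.
Qed.

Lemma momentum_flux x :
  mu (th x) * (Derive u x / v x) = - sigma * (u x - um) + (pressure Rg (v x) (th x) - pm).
Proof.
pose (p := fun x => pressure Rg (v x) (th x)).
pose (F := fun x => mu (th x) * (Derive u x / v x)).
pose (H := fun x => F x - (- sigma * u x + p x)).
assert (D : forall y, is_derive H y 0).
{ intros y; assert (E := proj1 (proj2 (system y))).
  assert (dF : ex_derive F y).
  { apply is_derive_flux; auto; try (eexists; auto; fail).
    eexists; exact (proj2 (C2_derivatives _ _ y u_C2 I)). }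
  assert (dp := ex_derive_pressure y).
  apply Derive_correct in dF; apply Derive_correct in dp.
  change (fun x => mu (th x) * (Derive u x / v x)) with F in E.
  evar_last; [apply (is_derive_minus F (fun x => - sigma * u x + p x)); [exact dF|]|].
  - apply (is_derive_plus (fun x => - sigma * u x) p); [apply is_derive_scal, du | exact dp].
  - unfold minus, plus, opp; simpl; rewrite <- E; ring. }
assert (C := constant_of_derive_zero H D).
assert (L : is_lim F m_infty (H 0 + (- sigma * um + pm))).
{ apply (is_lim_ext (fun x => H 0 + (- sigma * u x + p x))).
  - intros y; rewrite (C 0 y); unfold H; ring.
  - apply (is_lim_plus' _ _ _ (H 0) (- sigma * um + pm)); [apply is_lim_const|].
    apply (is_lim_plus' _ _ _ (- sigma * um) pm); [|exact pressure_lim].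
    apply (is_lim_scal_l u (- sigma) m_infty um u_lim). }
apply (flux_limit mu v th u (Derive u) vm thm um) in L; auto.
assert (E := C x 0); unfold H at 1 in E; unfold F, p in E; lra.
Qed.

(** The viscous work [N] is u times the momentum flux already found, so only the heat flux [F]
    remains and its limit at -oo exists. After the substitution the kinetic terms combine into a
    square of u - um. *)
Lemma energy_flux x :
  kappa (th x) * (Derive th x / v x)
  = - sigma * (Rg / (gamma - 1)) * (th x - thm) + sigma * (u x - um) ^ 2 / 2 + pm * (u x - um).
Proof.
pose (p := fun x => pressure Rg (v x) (th x)).
pose (e := fun x => energy Rg gamma (u x) (th x)).
pose (F := fun x => kappa (th x) * (Derive th x / v x)).
pose (N := fun x => mu (th x) * (u x * Derive u x / v x)).
pose (H := fun x => F x + N x - (- sigma * e x + p x * u x)).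
assert (NE : forall y, N y = u y * (- sigma * (u y - um) + (p y - pm))).
{ intros y; unfold p; rewrite <- momentum_flux; unfold N; unfold Rdiv; ring. }
assert (D : forall y, is_derive H y 0).
{ intros y; assert (E := proj2 (proj2 (system y))).
  assert (dF : ex_derive F y).
  { apply is_derive_flux; auto; try (eexists; auto; fail).
    eexists; exact (proj2 (C2_derivatives _ _ y th_C2 I)). }
  assert (dN : ex_derive N y).
  { apply (is_derive_flux mu v th (fun x => u x * Derive u x)); auto; try (eexists; auto; fail).
    apply (ex_derive_mult u (Derive u)); [eexists; auto|].
    eexists; exact (proj2 (C2_derivatives _ _ y u_C2 I)). }
  assert (de : ex_derive e y).
  { assert (A := du y); assert (B := dth y).
    unfold e, energy; auto_derive; repeat split; eexists; eassumption. }
  assert (dpu : ex_derive (fun x => p x * u x) y).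
  { apply (ex_derive_mult p u); [apply ex_derive_pressure | eexists; auto]. }
  apply Derive_correct in dF; apply Derive_correct in dN; apply Derive_correct in de;
    apply Derive_correct in dpu.
  change (fun x => kappa (th x) * (Derive th x / v x)) with F in E.
  change (fun x => mu (th x) * (u x * Derive u x / v x)) with N in E.
  evar_last.
  - apply (is_derive_minus (fun x => F x + N x) (fun x => - sigma * e x + p x * u x)).
    + apply (is_derive_plus F N); eassumption.
    + apply (is_derive_plus (fun x => - sigma * e x) (fun x => p x * u x));
        [apply is_derive_scal; exact de | exact dpu].
  - unfold minus, plus, opp; simpl; rewrite <- E; unfold e, p; ring. }
assert (C := constant_of_derive_zero H D).
pose (em := energy Rg gamma um thm).
assert (FE : forall y, F y = H 0 + (- sigma * e y + p y * u y)
   - u y * (- sigma * (u y - um) + (p y - pm))).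
{ intros y; rewrite <- NE, (C 0 y); unfold H; ring. }
assert (Lp := pressure_lim).
assert (Le : is_lim e m_infty em).
{ unfold e, em, energy.
  apply (is_lim_plus' _ _ _ (Rg / (gamma - 1) * thm) (um ^ 2 / 2)).
  - apply (is_lim_scal_l th (Rg / (gamma - 1)) m_infty thm th_lim).
  - apply (is_lim_ext (fun x => / 2 * (u x * u x))); [intros; field|].
    evar_last; [apply (is_lim_scal_l (fun x => u x * u x) (/ 2) m_infty (um * um))|].
    + apply (is_lim_mult u u m_infty um um); [exact u_lim | exact u_lim | exact I].
    + simpl; apply f_equal; field. }
assert (L : is_lim F m_infty (H 0 + (- sigma * em + pm * um)
   - um * (- sigma * (um - um) + (pm - pm)))).
{ apply (is_lim_ext _ _ _ _ (fun y => eq_sym (FE y))).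
  apply (is_lim_minus' _ _ _ (H 0 + (- sigma * em + pm * um))
    (um * (- sigma * (um - um) + (pm - pm)))).
  - apply (is_lim_plus' _ _ _ (H 0) (- sigma * em + pm * um)); [apply is_lim_const|].
    apply (is_lim_plus' _ _ _ (- sigma * em) (pm * um)).
    + apply (is_lim_scal_l e (- sigma) m_infty em Le).
    + apply (is_lim_mult p u m_infty pm um); [exact Lp | exact u_lim | exact I].
  - apply (is_lim_mult u (fun y => - sigma * (u y - um) + (p y - pm)) m_infty um
      (- sigma * (um - um) + (pm - pm))); [exact u_lim | | exact I].
    apply (is_lim_plus' _ _ _ (- sigma * (um - um)) (pm - pm)).
    + apply (is_lim_scal_l (fun y => u y - um) (- sigma) m_infty (um - um)).
      apply is_lim_minus'; [exact u_lim | apply is_lim_const].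
    + apply is_lim_minus'; [exact Lp | apply is_lim_const]. }
apply (flux_limit kappa v th th (Derive th) vm thm thm) in L; auto.
assert (E := FE x).
replace (H 0) with (sigma * em - pm * um) in E by lra.
change (kappa (th x) * (Derive th x / v x)) with (F x); rewrite E.
unfold e, em, energy; field; lra.
Qed.

End Profile.

(** Monotonicity supplies the three range fields: each component stays between its end values, whose
    differences are given by [Rankine_Hugoniot_facts]. *)
Lemma profile_wave (Rg gamma : R) (tau mu kappa : R -> R) (vm um thm vp up thp ss : R)
    (v u th : R -> R) :
  0 < Rg -> 1 < gamma -> positive_C2 tau -> positive_C2 mu -> positive_C2 kappa ->
  0 < vm -> 0 < thm -> 0 < vp ->
  Rankine_Hugoniot Rg gamma vm um thm vp up thp ->
  Lax vm um thm vp up thp ->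
  monotone_profile Rg gamma tau mu kappa vm um thm vp up thp v u th ->
  v 0 = (vm + vp) / 2 ->
  0 < ss * (vp - vm) ->
  exists w : wave Rg gamma tau mu kappa vm thm (pressure Rg vm thm) ss,
    (wVp w = vp - vm /\ wsg w = shock_speed Rg vm thm vp thp) /\
    (wV w = (fun x => v x - vm) /\ wU w = (fun x => u x - um) /\
     wT w = (fun x => th x - thm)) /\
    (wV1 w = Derive v /\ wU1 w = Derive u /\ wT1 w = Derive th) /\
    (wV2 w = Derive_n v 2 /\ wU2 w = Derive_n u 2 /\ wT2 w = Derive_n th 2).
Proof.
intros hRg hg htau hmu hkappa hvm hthm hvp RH HL [Sol (Mv & Mu & Mth)] v0 hs.
destruct Sol as (pv & pth & Cv & Cu & Cth & Sys & lv & lu & lth & lv' & lu' & lth').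
destruct (Rankine_Hugoniot_facts _ _ _ _ _ _ _ _ hRg hg hvm hthm hvp RH HL)
  as (F1 & F2 & F3 & F4 & F5).
set (sigma := shock_speed Rg vm thm vp thp) in *.
assert (Bv := monotone_between _ _ _ Mv lv lv').
assert (Bu := monotone_between _ _ _ Mu lu lu').
assert (Bth := monotone_between _ _ _ Mth lth lth').
assert (Vn : vp - vm <> 0) by (intros E; rewrite E in hs; lra).
assert (sg : 0 < ss * sigma).
{ apply Rmult_lt_reg_r with ((vp - vm) ^ 2); [now apply pow2_gt_0|].
  replace (ss * sigma * (vp - vm) ^ 2) with ((ss * (vp - vm)) * (sigma * (vp - vm))) by ring.
  rewrite Rmult_0_l; now apply Rmult_lt_0_compat. }
assert (shift : forall f, C2_on (fun _ => True) f -> forall c x,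
    is_derive (fun y => f y - c) x (Derive f x)).
{ intros f Hf c x; evar_last.
  - apply (is_derive_minus f (fun _ => c)); [|apply is_derive_const].
    exact (proj1 (C2_derivatives _ _ x Hf I)).
  - unfold minus, plus, opp, zero; simpl; ring. }
assert (second : forall f, C2_on (fun _ => True) f -> forall x,
    is_derive (Derive f) x (Derive_n f 2 x))
  by (intros f Hf x; exact (proj2 (C2_derivatives _ _ x Hf I))).
unshelve eexists (@Wave Rg gamma tau mu kappa vm thm (pressure Rg vm thm) ss
  (vp - vm) sigma (fun x => v x - vm) (fun x => u x - um) (fun x => th x - thm)
  (Derive v) (Derive u) (Derive th) (Derive_n v 2) (Derive_n u 2) (Derive_n th 2)
  hs sg F5 _ _ _ _ _ _ _ (shift v Cv vm) (shift u Cu um) (shift th Cth thm)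
  (second v Cv) (second u Cu) (second th Cth) _ _ _); cbv beta;
  [.. | repeat split].
- intros x; specialize (pv x); lra.
- intros x; specialize (pth x); lra.
- intros x; specialize (Bv x); destruct Bv; split; nra.
- intros x; rewrite <- (Rabs_Ropp (sigma * _)); replace (- (sigma * (vp - vm))) with (up - um) by lra.
  specialize (Bu x); unfold Rabs; repeat destruct Rcase_abs; lra.
- intros x; rewrite <- F4.
  specialize (Bth x); unfold Rabs; repeat destruct Rcase_abs; lra.
- rewrite v0; field.
(* If v' vanished identically, v would be constant, while its two limits differ. *)
- intros E.
  assert (C : forall y, v y = v 0).
  { intros y; apply constant_of_derive_zero; intros z; rewrite <- (E z).
    exact (proj1 (C2_derivatives _ _ z Cv I)). }
  assert (L : forall l x, is_lim v x (Finite l) -> l = v 0).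
  { intros l x Hl; apply (is_lim_ext v (fun _ => v 0)) in Hl; [|exact C].
    apply is_lim_unique in Hl; rewrite Lim_const in Hl; injection Hl; auto. }
  apply L in lv; apply L in lv'; lra.
- intros x; replace (thm + (th x - thm)) with (th x) by ring.
  replace (vm + (v x - vm)) with (v x) by ring.
  exact (mass_flux Rg gamma tau mu kappa vm um thm htau hvm hthm
    sigma v u th pv pth Cv Cu Cth Sys lv lu lth x).
- intros x; replace (thm + (th x - thm)) with (th x) by ring.
  replace (vm + (v x - vm)) with (v x) by ring.
  exact (momentum_flux Rg gamma tau mu kappa vm um thm hmu hvm hthm
    sigma v u th pv pth Cv Cu Cth Sys lv lu lth x).
- intros x; replace (thm + (th x - thm)) with (th x) by ring.
  replace (vm + (v x - vm)) with (v x) by ring.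
  exact (energy_flux Rg gamma tau mu kappa vm um thm hg hmu hkappa hvm hthm
    sigma v u th pv pth Cv Cu Cth Sys lv lu lth x).
Qed.

Theorem theorem1p2 (Rg gamma : R) (tau mu kappa : R -> R)
    (hRg : 0 < Rg) (hgamma : 1 < gamma)
    (htau : positive_C2 tau) (hmu : positive_C2 mu) (hkappa : positive_C2 kappa)
    (vm um thm : R) (hvm : 0 < vm) (hthm : 0 < thm) :
  exists eps0 C C1 : R, 0 < eps0 /\ 0 < C /\ 0 < C1 /\
  forall vp up thp : R, 0 < vp -> 0 < thp ->
  Rankine_Hugoniot Rg gamma vm um thm vp up thp ->
  Lax vm um thm vp up thp ->
  let eps := Rabs (vm - vp) in
  0 < eps < eps0 ->
  forall v u th : R -> R,
  monotone_profile Rg gamma tau mu kappa vm um thm vp up thp v u th ->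
  v 0 = (vm + vp) / 2 ->
  let sigma_eps := shock_speed Rg vm thm vp thp in
  let sigma_star := limit_speed Rg gamma vm thm vp in
  let A := coefA Rg gamma tau mu kappa vm thm vp in
  (* (1) *)
  ((forall xi : R, xi <= 0 ->
      norm3 (v xi - vm) (u xi - um) (th xi - thm)
        <= C * eps * exp (- C1 * eps * Rabs xi)) /\
   (forall xi : R, 0 <= xi ->
      norm3 (v xi - vp) (u xi - up) (th xi - thp)
        <= C * eps * exp (- C1 * eps * Rabs xi))) /\
  (* (2) *)
  (forall xi : R,
     norm3 (Derive v xi) (Derive u xi) (Derive th xi)
       <= C * eps ^ 2 * exp (- C1 * eps * Rabs xi)) /\
  (* (3) *)
  (forall xi : R,
     norm3 (Derive_n v 2 xi) (Derive_n u 2 xi) (Derive_n th 2 xi)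
       <= C * eps * norm3 (Derive v xi) (Derive u xi) (Derive th xi)) /\
  (* (4) *)
  (forall xi : R,
     / C * Rabs (Derive v xi) <= Rabs (Derive u xi) <= C * Rabs (Derive v xi) /\
     / C * Rabs (Derive v xi) <= Rabs (Derive th xi) <= C * Rabs (Derive v xi) /\
     Rabs (Derive u xi + sigma_star * Derive v xi)
       <= C * eps * Rabs (Derive v xi) /\
     Rabs (Derive th xi + (gamma - 1) * pressure Rg vm thm / Rg * Derive v xi)
       <= C * eps * Rabs (Derive v xi)) /\
  (* (5) *)
  Rabs (sigma_eps - sigma_star) <= C * eps /\
  (* (6) *)
  ((vp < vm ->
      forall xi : R, Derive v xi < 0 /\ Derive u xi < 0 /\ 0 < Derive th xi) /\
   (vm < vp ->
      forall xi : R, 0 < Derive v xi /\ Derive u xi < 0 /\ Derive th xi < 0)) /\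
  (* (7) *)
  (forall xi : R,
     Rabs (Derive v xi - A * (vp - v xi) * (v xi - vm))
       <= C * eps * ((vp - v xi) * (v xi - vm))).
Proof.
set (pm := pressure Rg vm thm).
assert (hpm : pm * vm = Rg * thm) by (unfold pm, pressure; field; lra).
assert (pm0 : 0 < pm) by (unfold pm, pressure; apply Rdiv_lt_0_compat; [apply Rmult_lt_0_compat|]; lra).
assert (q0 : 0 < gamma * pm / vm) by (apply Rdiv_lt_0_compat; [apply Rmult_lt_0_compat|]; lra).
set (s := sqrt (gamma * pm / vm)).
assert (s0 : 0 < s) by now apply sqrt_lt_R0.
assert (hs : s ^ 2 * vm = gamma * pm) by (unfold s; rewrite pow2_sqrt by lra; field; lra).
assert (hs' : (- s) ^ 2 * vm = gamma * pm) by (rewrite <- hs; ring).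
(* The constants must precede the choice of the right state, so both families are treated before it
   is introduced. *)
destruct (estimates_hold Rg gamma tau mu kappa vm thm pm s) as (C & hC & e & he & H); try assumption.
destruct (estimates_hold Rg gamma tau mu kappa vm thm pm (- s)) as (C' & hC' & e' & he' & H');
  try assumption.
(* A is odd in the limit speed, so both families share the decay rate a / 4. *)
pose (a := Rabs (A Rg gamma tau mu kappa thm s)).
assert (Ea : Rabs (A Rg gamma tau mu kappa thm (- s)) = a).
{ unfold a; rewrite <- Rabs_Ropp; f_equal; unfold A; unfold Rdiv; ring. }
assert (a0 : 0 < a).
{ apply Rabs_pos_lt; intros E.
  assert (Z := A_ss Rg gamma tau mu kappa vm thm pm s); rewrite E in Z.
  rewrite Rmult_0_l in Z; apply (Rlt_irrefl 0), Z; assumption. }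
exists (Rmin e e'), (C + C'), (a / 4).
split; [now apply Rmin_pos|]; split; [lra|]; split; [lra|].
intros vp up thp hvp hthp RH HL d hd v u th prof v0 sigma_eps sigma_star A0.
fold pm in sigma_star |- *.
assert (Ed : d = Rabs (vp - vm)) by (unfold d; apply Rabs_minus_sym).
assert (K : exists ss, sigma_star = ss /\ 0 < ss * (vp - vm) /\
   Rabs (A Rg gamma tau mu kappa thm ss) = a /\
   forall w : wave Rg gamma tau mu kappa vm thm pm ss, Rabs (wVp w) <= d ->
     forall x, estimates Rg gamma tau mu kappa vm thm pm ss (C + C') (w, x)).
{ unfold sigma_star, limit_speed; fold pm; fold s.
  destruct Rlt_dec as [Hlt|Hge].
  - exists (- s); split; [reflexivity|]; split; [nra|]; split; [exact Ea|].
    intros w Hw x; apply H'; [|lra].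
    apply (Rle_trans _ _ _ Hw), Rle_trans with (Rmin e e'); [lra | apply Rmin_r].
  - exists s; split; [reflexivity|]; split; [|split; [reflexivity|]].
    + destruct HL; nra.
    + intros w Hw x; apply H; [|lra].
      apply (Rle_trans _ _ _ Hw), Rle_trans with (Rmin e e'); [lra | apply Rmin_l]. }
destruct K as (ss & Ess & hss & Ea' & K).
assert (EA : A0 = A Rg gamma tau mu kappa thm sigma_star) by reflexivity.
assert (PW := profile_wave Rg gamma tau mu kappa vm um thm vp up thp ss v u th).
fold pm in PW.
destruct PW as (w & (W1 & W2) & (W3 & W4 & W5) & (W6 & W7 & W8) & (W9 & W10 & W11));
  try assumption.
destruct (Rankine_Hugoniot_facts Rg gamma vm um thm vp up thp) as (_ & F2 & _ & F4 & _);
  try assumption.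
assert (Est : forall x, estimates Rg gamma tau mu kappa vm thm pm ss (C + C') (w, x)).
{ apply K; rewrite W1, Ed; apply Rle_refl. }
clear K H H'.
unfold estimates, Up, Tp, Q, eps, sg, V, U, T, V1, U1, T1, V2, U2, T2 in Est.
simpl fst in Est; simpl snd in Est.
rewrite Ea', W1, W2, W3, W4, W5, W6, W7, W8, W9, W10, W11, <- Ed in Est.
(* Turns the expressions [Up] and [Tp] back into up - um and thp - thm. *)
fold pm in F4; fold sigma_eps in F2, F4, Est; rewrite <- F2, <- F4 in Est.
cbv beta in Est.
rewrite <- Ess, <- EA in Est.
rewrite <- Ess in hss.
split; [split | split; [| split; [| split; [| split; [| split; [split |]]]]]].
- intros x; apply (Est x).
- intros x Hx; assert (B := proj2 (proj1 (Est x)) Hx).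
  replace (v x - vp) with (v x - vm - (vp - vm)) by ring.
  replace (u x - up) with (u x - um - (up - um)) by ring.
  replace (th x - thp) with (th x - thm - (thp - thm)) by ring.
  exact B.
- intros x; apply (Est x).
- intros x; apply (Est x).
- intros x; apply (Est x).
- apply (Est 0).
- intros Hlt x; destruct (Est x) as (_ & _ & _ & _ & _ & (B1 & B2 & B3) & _).
  repeat split; nra.
- intros Hlt x; destruct (Est x) as (_ & _ & _ & _ & _ & (B1 & B2 & B3) & _).
  repeat split; nra.
- intros x; destruct (Est x) as (_ & _ & _ & _ & _ & _ & B).
  rewrite Rmult_assoc.
  replace ((vp - v x) * (v x - vm)) with ((v x - vm) * (vp - vm - (v x - vm))) by ring.
  exact B.
Qed.
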